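(* Let $\mathcal{F}_1,\mathcal{F}_2,\mathcal{F}_3$ be the foliations of $\mathbb{P}^2(\mathbb{C})$ described in the affine chart $Z=1$ by $\omega_1=x^2\,\mathrm{d}x+y^2(x\,\mathrm{d}y-y\,\mathrm{d}x)$, $\omega_2=x^2\,\mathrm{d}x+(x+y^2)(x\,\mathrm{d}y-y\,\mathrm{d}x)$ and $\omega_3=xy\,\mathrm{d}x+(x^2+y^2)(x\,\mathrm{d}y-y\,\mathrm{d}x)$ respectively. For each $i\in\{1,2,3\}$ and every regular (non-singular) point $m$ of $\mathcal{F}_i$, the leaf of $\mathcal{F}_i$ through $m$ is an entire curve, i.e. a curve parametrized by a holomorphic map from $\mathbb{C}$ to (an affine chart) $\mathbb{C}^2$. In fact $\mathcal{F}_1$, $\mathcal{F}_2$ and $\mathcal{F}_3$ are defined, in the affine chart $X=1$, by complete polynomial vector fields.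
   Context: A foliation of degree $N$ on $\mathbb{P}^2(\mathbb{C})$ (homogeneous coordinates $(X:Y:Z)$) is given, up to a nonzero scalar, by a homogeneous $1$-form $\omega=a\,\mathrm{d}X+b\,\mathrm{d}Y+c\,\mathrm{d}Z$ with $a,b,c$ homogeneous of degree $N+1$ without common factor and $aX+bY+cZ=0$; its singular points are the common zeros of $a,b,c$ in $\mathbb{P}^2(\mathbb{C})$. In the chart $Z=1$, $x=X/Z$, $y=Y/Z$, it is described by the restriction of $\omega$. The foliations $\mathcal{F}_1,\mathcal{F}_2,\mathcal{F}_3$ have degree $2$. Leaves are the leaves of the regular holomorphic foliation on the complement of the singular set. A polynomial vector field on $\mathbb{C}^2$ is complete if its flow is defined for all complex times; it defines the foliation if it has isolated zeros and lies in the kernel of the defining $1$-form. *)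

(* Defs.v *)
From HB Require Import structures.
From mathcomp Require Import all_boot all_order all_algebra ring.
From mathcomp Require Import all_classical all_reals all_analysis.
From mathcomp Require Import complex.
From Stdlib Require Import Relation_Operators.
(* The notations of mpoly clash with those of MathComp-Analysis, so only its
   canonical instances and coercions are imported. *)
From mathcomp Require mpoly.
Import (canonicals, coercions) mpoly.

Set Implicit Arguments.
Unset Strict Implicit.
Unset Printing Implicit Defensive.

Import Order.TTheory GRing.Theory Num.Theory.
Import numFieldNormedType.Exports.
Local Open Scope classical_set_scope.
Local Open Scope ring_scope.

(* The field of complex numbers enters as K : numClosedFieldType, with the
   topology of its norm; [derivable f z 1] is then complex differentiability. *)

Definition mvar (K : numClosedFieldType) (n : nat) (i : 'I_n) :
    mpoly.mpoly n K :=
  mpoly.mpolyX K (mpoly.mnm1 i).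

(* The row (a_0, ..., a_(n-1)) stands for a_0 dx_0 + ... + a_(n-1) dx_(n-1). *)
Definition one_form (K : numClosedFieldType) (n : nat) : Type :=
  'rV[mpoly.mpoly n K]_n.

Definition form_at (K : numClosedFieldType) (n : nat) (w : one_form K n)
    (u v : 'rV[K]_n) : K :=
  \sum_i mpoly.meval (u 0) (w 0 i) * v 0 i.

Record foliation (K : numClosedFieldType) (N : nat) := Foliation {
  foliation_form :> 'rV[mpoly.mpoly 3 K]_3;
  foliation_homog : forall i,
    foliation_form 0 i \is mpoly.ishomog1 N.+1 mpoly.mdeg;
  foliation_coprime : forall d : mpoly.mpoly 3 K,
    (forall i, exists q, foliation_form 0 i = d * q) ->
    (mpoly.msize d <= 1)%N;
  foliation_radial : \sum_i foliation_form 0 i * mvar K i = 0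
}.

(* P^2: the lines through 0 in K^3, with homogeneous coordinates
   (X : Y : Z) indexed by 0, 1, 2. *)
Definition proj_plane (K : numClosedFieldType) : Type :=
  {l : {vspace 'rV[K]_3} | \dim l == 1%N}.

Definition singular (K : numClosedFieldType) (N : nat) (F : foliation K N)
    (p : proj_plane K) : Prop :=
  forall v, v \in sval p -> forall i, mpoly.meval (v 0) (F 0 i) = 0.

(* The standard affine chart in which the k-th homogeneous coordinate is 1,
   the other two keeping their order: (x, y) |-> (x : y : 1) for k = 2 and
   (y, z) |-> (1 : y : z) for k = 0. *)
Definition chart_vec (K : numClosedFieldType) (k : 'I_3) (u : 'rV[K]_2) :
    'rV[K]_3 :=
  \row_i oapp (u 0) 1 (unlift k i).

Lemma dim_chart_vec (K : numClosedFieldType) (k : 'I_3) (u : 'rV[K]_2) :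
  \dim <[chart_vec k u]>%VS == 1%N.
Proof.
rewrite dim_vline; rewrite eqb1; apply/eqP => /matrixP/(_ 0 k)/eqP.
by rewrite !mxE unlift_none /= oner_eq0.
Qed.

Definition chart (K : numClosedFieldType) (k : 'I_3) (u : 'rV[K]_2) :
    proj_plane K :=
  exist _ <[chart_vec k u]>%VS (dim_chart_vec k u).

(* The pullback of w by u |-> chart_vec k u. *)
Definition chart_form (K : numClosedFieldType) (k : 'I_3) (w : one_form K 3) :
    one_form K 2 :=
  \row_j mpoly.comp_mpoly
    [tuple oapp (@mvar K 2) 1 (unlift k i) | i < 3] (w 0 (lift k j)).

Definition described_in_chart (K : numClosedFieldType) (N : nat)
    (F : foliation K N) (k : 'I_3) (w : one_form K 2) : Prop :=
  exists2 c : K, c != 0 & chart_form k F = mpoly.mpolyC 2 c *: w.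

(* A holomorphic immersion of the open unit disc, tangent to F and avoiding its
   singular set. It need not be injective; its image still lies in one leaf. *)
Definition integral_disc (K : numClosedFieldType) (N : nat)
    (F : foliation K N) (k : 'I_3) (g : K -> 'rV[K]_2) : Prop :=
  forall s : K, `|s| < 1 ->
    [/\ derivable g s 1, derive1 g s != 0, ~ singular F (chart k (g s)) &
        form_at (chart_form k F) (g s) (derive1 g s) = 0].

Definition same_plaque (K : numClosedFieldType) (N : nat) (F : foliation K N)
    (p q : proj_plane K) : Prop :=
  exists k g s t, [/\ integral_disc F k g, `|s| < 1, `|t| < 1,
    p = chart k (g s) & q = chart k (g t)].

(* The leaf through m consists of the points joined to m by a finite chain of
   images of integral discs; it is empty if m is singular. *)
Definition leaf (K : numClosedFieldType) (N : nat) (F : foliation K N)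
    (m : proj_plane K) : set (proj_plane K) :=
  [set p | clos_trans (proj_plane K) (same_plaque F) m p].

Definition entire_curve (K : numClosedFieldType) (L : set (proj_plane K)) :
    Prop :=
  exists k (g : K -> 'rV[K]_2),
    (forall s : K, derivable g s 1) /\ L = range (fun s : K => chart k (g s)).

(* Polynomial vector fields on K^2, as the row of their components. *)
Definition vector_field (K : numClosedFieldType) : Type :=
  'rV[mpoly.mpoly 2 K]_2.

Definition field_at (K : numClosedFieldType) (V : vector_field K)
    (u : 'rV[K]_2) : 'rV[K]_2 :=
  \row_j mpoly.meval (u 0) (V 0 j).

Definition complete (K : numClosedFieldType) (V : vector_field K) : Prop :=
  forall u : 'rV[K]_2, exists g : K -> 'rV[K]_2,
    g 0 = u /\ forall s : K, is_derive s 1 g (field_at V (g s)).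

Definition defined_by_field (K : numClosedFieldType) (N : nat)
    (F : foliation K N) (k : 'I_3) (V : vector_field K) : Prop :=
  (forall u : 'rV[K]_2, field_at V u = 0 ->
     \forall v \near u^', field_at V v != 0) /\
  \sum_j chart_form k F 0 j * V 0 j = 0.

Section Forms.

Variable K : numClosedFieldType.

Let x : mpoly.mpoly 2 K := mvar K 0.
Let y : mpoly.mpoly 2 K := mvar K 1.
Let dx : one_form K 2 := delta_mx 0 0.
Let dy : one_form K 2 := delta_mx 0 1.

Definition omega1 : one_form K 2 :=
  x ^+ 2 *: dx + y ^+ 2 *: (x *: dy - y *: dx).

Definition omega2 : one_form K 2 :=
  x ^+ 2 *: dx + (x + y ^+ 2) *: (x *: dy - y *: dx).

Definition omega3 : one_form K 2 :=
  (x * y) *: dx + (x ^+ 2 + y ^+ 2) *: (x *: dy - y *: dx).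

End Forms.

(* Each omega_i does come from a foliation of degree 2 in the chart Z = 1. *)
Section Existence.

Variable K : numClosedFieldType.
Let X : mpoly.mpoly 3 K := mvar K 0.
Let Y : mpoly.mpoly 3 K := mvar K 1.
Let Z : mpoly.mpoly 3 K := mvar K ord_max.
Let x : mpoly.mpoly 2 K := mvar K 0.
Let y : mpoly.mpoly 2 K := mvar K 1.

Lemma mvarXn_neq0 (i : 'I_3) n : mvar K i ^+ n != 0.
Proof.
apply/expf_neq0/eqP => h.
have := congr1 (@mpoly.mlead _ _) h; rewrite mpoly.mleadXm mpoly.mlead0.
move=> /(congr1 (fun f : mpoly.multinom 3 => f i)).
by rewrite mpoly.mnm1E mpoly.mnm0E eqxx.
Qed.

Lemma mlead_mvarX (i : 'I_3) n :
  mpoly.mlead (mvar K i ^+ n) = mpoly.mnm_muln (mpoly.mnm1 i) n.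
Proof.
by rewrite mpoly.mleadX ?mpoly.mleadXm // -[mvar K i]expr1 mvarXn_neq0.
Qed.

Lemma msize_dvd_mvarX (d p q : mpoly.mpoly 3 K) m n :
  d * p = X ^+ m -> d * q = Y ^+ n -> (mpoly.msize d <= 1)%N.
Proof.
move=> hp hq.
have d0 : d != 0.
  by apply: contraTneq (mvarXn_neq0 0 m) => d0; rewrite -hp d0 mul0r eqxx.
have p0 : p != 0.
  by apply: contraTneq (mvarXn_neq0 0 m) => p0; rewrite -hp p0 mulr0 eqxx.
have q0 : q != 0.
  by apply: contraTneq (mvarXn_neq0 1 n) => q0; rewrite -hq q0 mulr0 eqxx.
have ld : mpoly.mlead d = mpoly.mnm0.
  have h1 := congr1 (@mpoly.mlead _ _) hp.
  have h2 := congr1 (@mpoly.mlead _ _) hq.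
  rewrite mpoly.mleadM // mlead_mvarX in h1.
  rewrite mpoly.mleadM // mlead_mvarX in h2.
  apply/mpoly.mnmP => i; rewrite mpoly.mnm0E.
  have := congr1 (fun f : mpoly.multinom 3 => f i) h1.
  have := congr1 (fun f : mpoly.multinom 3 => f i) h2.
  rewrite /= !mpoly.mnmDE !mpoly.mulmnE !mpoly.mnm1E => e2 e1.
  move: e1 e2; case: i => [[|[|[|//]]] hi] /=; rewrite ?mul0n ?mul1n.
  - by move=> _ /eqP; rewrite addn_eq0 => /andP[/eqP].
  - by move=> /eqP; rewrite addn_eq0 => /andP[/eqP].
  - by move=> /eqP; rewrite addn_eq0 => /andP[/eqP].
by rewrite -mpoly.mlead_deg // ld mpoly.mdeg0.
Qed.

Definition form_of_coefs (a b c : mpoly.mpoly 3 K) : 'rV[mpoly.mpoly 3 K]_3 :=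
  \row_i tnth [tuple a; b; c] i.

Lemma ord3_ind (P : 'I_3 -> Prop) : P 0 -> P 1 -> P ord_max -> forall i, P i.
Proof.
move=> P0 P1 P2 [[|[|[|//]]] hi]; [move: P0|move: P1|move: P2];
  congr P; exact/val_inj.
Qed.

Lemma mvarM3_homog (i j k : 'I_3) :
  mvar K i * mvar K j * mvar K k \is mpoly.ishomog1 3 (@mpoly.mdeg 3).
Proof.
have h1 l : mvar K l \is mpoly.ishomog1 1 (@mpoly.mdeg 3).
  by rewrite mpoly.dhomogX; apply/eqP; exact: mpoly.mdeg1.
exact: (mpoly.dhomogM (mpoly.dhomogM (h1 i) (h1 j)) (h1 k)).
Qed.

Lemma exists_foliation (w : one_form K 2) (a b c : mpoly.mpoly 3 K) m n
    (p1 p2 p3 q1 q2 q3 : mpoly.mpoly 3 K) :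
  a \is mpoly.ishomog1 3 (@mpoly.mdeg 3) ->
  b \is mpoly.ishomog1 3 (@mpoly.mdeg 3) ->
  c \is mpoly.ishomog1 3 (@mpoly.mdeg 3) ->
  a * p1 + b * p2 + c * p3 = X ^+ m ->
  a * q1 + b * q2 + c * q3 = Y ^+ n ->
  a * X + b * Y + c * Z = 0 ->
  mpoly.comp_mpoly [tuple x; y; 1] a = w 0 0 ->
  mpoly.comp_mpoly [tuple x; y; 1] b = w 0 1 ->
  exists F : foliation K 2, described_in_chart F ord_max w.
Proof.
move=> ha hb hc hX hY hr wa wb.
pose f := form_of_coefs a b c.
have h0 : f 0 0 = a by rewrite mxE.
have h1 : f 0 1 = b by rewrite mxE.
have h2 : f 0 ord_max = c by rewrite mxE.
have hh : forall i, f 0 i \is mpoly.ishomog1 3 (@mpoly.mdeg 3).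
  by apply: ord3_ind; rewrite ?h0 ?h1 ?h2.
have hcop (d : mpoly.mpoly 3 K) :
    (forall i, exists q, f 0 i = d * q) -> (mpoly.msize d <= 1)%N.
  move=> hd; have [a' ea] := hd 0; have [b' eb] := hd 1.
  have [c' ec] := hd ord_max.
  move: ea eb ec; rewrite h0 h1 h2 => ea eb ec.
  apply: (@msize_dvd_mvarX d (a' * p1 + b' * p2 + c' * p3)
    (a' * q1 + b' * q2 + c' * q3) m n).
    by rewrite -hX ea eb ec; ring.
  by rewrite -hY ea eb ec; ring.
have hrad : \sum_i f 0 i * mvar K i = 0.
  rewrite !big_ord_recl big_ord0 /=.
  have -> : lift ord0 ord0 = 1 :> 'I_3 by exact/val_inj.
  have -> : lift ord0 (lift ord0 ord0) = ord_max :> 'I_3 by exact/val_inj.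
  by rewrite h0 h1 h2 addr0 addrA -[RHS]hr.
exists (Foliation hh hcop hrad), 1; rewrite ?oner_eq0 // rmorph1 scale1r.
have -> : chart_form ord_max (Foliation hh hcop hrad) =
    \row_j mpoly.comp_mpoly [tuple x; y; 1] (f 0 (lift ord_max j)).
  rewrite /chart_form /=; apply/rowP => j; rewrite !mxE /=.
  congr (mpoly.comp_mpoly _ _).
  apply: eq_from_tnth; rewrite /=; apply: ord3_ind; rewrite tnth_mktuple.
  - have -> : 0 = lift ord_max (0 : 'I_2) :> 'I_3 by exact/val_inj.
    by rewrite liftK.
  - have -> : 1 = lift ord_max (1 : 'I_2) :> 'I_3 by exact/val_inj.
    by rewrite liftK.
  - by rewrite unlift_none.
apply/rowP => j; rewrite mxE.
case: j => [[|[|//]] hj].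
  have -> : Ordinal hj = 0 by exact/val_inj.
  have -> : lift ord_max (0 : 'I_2) = 0 :> 'I_3 by exact/val_inj.
  by rewrite h0.
have -> : Ordinal hj = 1 by exact/val_inj.
have -> : lift ord_max (1 : 'I_2) = 1 :> 'I_3 by exact/val_inj.
by rewrite h1.
Qed.

Let cE := (rmorphB, rmorphD, rmorphN, rmorphM, rmorphXn).
Let cX := mpoly.comp_mpolyXU.

Lemma exists_foliation1 :
  exists F : foliation K 2, described_in_chart F ord_max (omega1 K).
Proof.
pose a := X*X*Z - Y*Y*Y; pose b := X*Y*Y; pose c := - (X*X*X).
apply: (@exists_foliation _ a b c 3 6 0 0 (-1) (a - 2 * X^+2*Z) 0 (-X*Z^+2)).
- by rewrite rpredB // mvarM3_homog.
- exact: mvarM3_homog.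
- by rewrite rpredN mvarM3_homog.
- by rewrite /a /b /c; ring.
- by rewrite /a /b /c; ring.
- by rewrite /a /b /c; ring.
- by rewrite /a /X /Y /Z !cE /= /mvar !cX /= !mxE /=; rewrite /x /y /mvar; ring.
- by rewrite /b /X /Y /Z !cE /= /mvar !cX /= !mxE /=; rewrite /x /y /mvar; ring.
Qed.

Lemma exists_foliation2 :
  exists F : foliation K 2, described_in_chart F ord_max (omega2 K).
Proof.
pose a := X*X*Z - X*Y*Z - Y*Y*Y; pose b := X*X*Z+X*Y*Y; pose c := - (X*X*X).
pose u := X*Z*(X-Y).
apply: (@exists_foliation _ a b c 3 9 0 0 (-1)
  (-(3*u^+2 - 3*u*a + a^+2)) 0 (-(Z^+3*(X-Y)^+3))).
- by rewrite !rpredB // mvarM3_homog.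
- by rewrite rpredD // mvarM3_homog.
- by rewrite rpredN mvarM3_homog.
- by rewrite /a /b /c; ring.
- by rewrite /a /b /c /u; ring.
- by rewrite /a /b /c; ring.
- by rewrite /a /X /Y /Z !cE /= /mvar !cX /= !mxE /=; rewrite /x /y /mvar; ring.
- by rewrite /b /X /Y /Z !cE /= /mvar !cX /= !mxE /=; rewrite /x /y /mvar; ring.
Qed.

Lemma exists_foliation3 :
  exists F : foliation K 2, described_in_chart F ord_max (omega3 K).
Proof.
pose a := X*Y*Z - X*X*Y - Y*Y*Y; pose b := X*X*X+X*Y*Y; pose c := - (X*X*Y).
apply: (@exists_foliation _ a b c 4 6 0 X Y
  (a-2*(X*Y*(Z-X))) 0 (-(Y*(Z-X)^+2))).
- by rewrite !rpredB // mvarM3_homog.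
- by rewrite rpredD // mvarM3_homog.
- by rewrite rpredN mvarM3_homog.
- by rewrite /a /b /c; ring.
- by rewrite /a /b /c; ring.
- by rewrite /a /b /c; ring.
- by rewrite /a /X /Y /Z !cE /= /mvar !cX /= !mxE /=; rewrite /x /y /mvar; ring.
- by rewrite /b /X /Y /Z !cE /= /mvar !cX /= !mxE /=; rewrite /x /y /mvar; ring.
Qed.

End Existence.

(* Main.v *)
Require Import Defs.
From mathcomp Require Import all_boot all_order all_algebra ring lra.
From mathcomp Require Import all_classical all_reals all_analysis.
From mathcomp Require Import complex.
From mathcomp Require mpoly.
Import (canonicals, coercions) mpoly.

Set Implicit Arguments.
Unset Strict Implicit.
Unset Printing Implicit Defensive.

Import Order.TTheory GRing.Theory Num.Theory.
Import numFieldNormedType.Exports.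
Local Open Scope classical_set_scope.
Local Open Scope ring_scope.

(** Write x = Y/X and y = Z/X for the coordinates of the chart X = 1. There the
    three foliations are given by

      x^2 dx - dy,   (y + x^2) dx - dy,   (1 + x^2) dx - x dy,

    hence by the vector fields (1, x^2), (1, y + x^2) and (x, 1 + x^2). These
    have no zeros, and they are triangular, so their flows are explicit
    combinations of polynomials and exponentials defined for all complex times.
    The functions

      y - x^3/3,   e^(-x) (y + x^2 + 2x + 2),   x e^(x^2/2 - y)

    are first integrals, and each of their level sets is one single orbit
    (solvable_omega1, solvable_omega2, solvable_omega3). The line X = 0 is
    invariant, its only singular point is (0 : 0 : 1), and the rest of it is a
    copy of C.

    It remains to see that a leaf is no larger than such an orbit or such a
    line, i.e. that an integral disc stays where it starts. Discs are only known
    to be complex differentiable, and a uniqueness argument for differential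
    equations would require a bound on their derivative; the first integral
    avoids this. Where X does not vanish its derivative along the disc is zero,
    so it is constant along segments (first_integral_segment). If a disc met
    both X = 0 and its complement, then on a segment up to the first point of
    X = 0 the first integral would be constant while x tends to infinity and
    y/x = Z/Y stays bounded, since Y does not vanish at a regular point of
    X = 0 (disc_avoids_infinity).

    This is impossible. For the first foliation it contradicts the sizes of x^3
    and y. For the other two the level equation takes the form e^v c = w, with
    v unbounded and w close to v^2. Comparing sizes, Re v is small compared
    with Im v, so that w is close to a negative real number and e^v c has
    negative real part. But Im v is continuous and unbounded, so it varies by
    pi, and this reverses e^v c (half_turn, cexp_no_escape). *)

(** * Complex derivatives and real segments *)

(** The difference quotient multiplied out: this form passes easily between the
    real and the complex derivative. *)
Lemma is_deriveP (K : numFieldType) (f : K -> K) (z d : K) :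
  is_derive z 1 f d <-> forall e : K, 0 < e -> exists2 r : K, 0 < r &
    forall k, `|k| < r -> `|f (k + z) - f z - k * d| <= e * `|k|.
Proof.
have dq (k : K) : k != 0 ->
    `|f (k + z) - f z - k * d| = `|d - k^-1 * (f (k + z) - f z)| * `|k|.
  by move=> k0; rewrite -normrM mulrBl mulrAC mulVf// mul1r distrC [k * d]mulrC.
have <- : (h^-1 *: (f (h *: 1 + z) - f z)) @[h --> 0^'] --> d <-> is_derive z 1 f d.
  split=> [fd|[/cvg_ex[/= l fl] <-]].
    by split; [apply/cvg_ex; exists d|exact/cvg_lim].
  by have -> : 'D_1 f z = l by exact/cvg_lim.
split=> [/cvgrPdist_le fd e e0|H].
  have [/= r r0 rP] := fd e e0; exists r => // k kr.
  have [->|k0] := eqVneq k 0; first by rewrite add0r mul0r !subrr normr0 mulr0.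
  rewrite dq// ler_wpM2r//; have := rP k.
  by rewrite /ball_/= sub0r normrN /GRing.scale/= mulr1; exact.
apply/cvgrPdist_le => e e0; have [r r0 rP] := H e e0.
exists r => //= k; rewrite /ball_/= sub0r normrN => kr k0.
by have := rP _ kr; rewrite dq// ler_pM2r ?normr_gt0// /GRing.scale/= mulr1.
Qed.

Lemma is_derive_rowP (K : numFieldType) n (g : K -> 'rV[K]_n) (s : K)
    (d : 'rV[K]_n) :
  is_derive s 1 g d <-> forall j, is_derive s 1 (fun t => g t 0 j) (d 0 j).
Proof.
split=> [[/cvg_ex[/= l gl] <-] j|H].
  have -> : 'D_1 g s = l by exact/cvg_lim.
  have gj : (h^-1 *: (g (h *: 1 + s) 0 j - g s 0 j)) @[h --> 0^'] --> l 0 j.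
    have gj := cvg_comp _ _ gl (@coord_continuous K 1 n 0 j l).
    apply: cvg_trans gj; apply: near_eq_cvg.
    by near=> h; rewrite /= !mxE.
  by split; [apply/cvg_ex; exists (l 0 j)|exact/cvg_lim].
have gd : (h^-1 *: (g (h *: 1 + s) - g s)) @[h --> 0^'] --> d.
  move=> A [/= B Bd BA].
  have Bh : \forall h \near 0^', forall j,
      B 0 j (h^-1 *: (g (h *: 1 + s) 0 j - g s 0 j)).
    apply: filter_forall => j; have [/cvg_ex[/= l gl] dl] := H j.
    have e : l = d 0 j by rewrite -dl; apply/esym/cvg_lim.
    by rewrite e in gl; exact: gl (Bd 0 j).
  apply: filterS Bh => h Bh; apply: BA => i j.
  by rewrite ord1; have := Bh j; rewrite !mxE.
by split; [apply/cvg_ex; exists d|exact/cvg_lim].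
Unshelve. all: by end_near. Qed.

Lemma is_derive_chain (K : numFieldType) (f g : K -> K) (x a b : K) :
  is_derive (g x) 1 f a -> is_derive x 1 g b -> is_derive x 1 (f \o g) (a * b).
Proof.
move=> [df <-{a}] [dg <-{b}].
have Df : differentiable f (g x) by exact/derivable1_diffP.
have Dg : differentiable g x by exact/derivable1_diffP.
apply: DeriveDef; first exact/derivable1_diffP/differentiable_comp.
rewrite deriveE; last exact/differentiable_comp.
rewrite diff_comp//= (congr1 (fun h => h _) (diff1E Df)) derive1E -deriveE//.
by rewrite /GRing.scale/= mulrC.
Qed.

Section ComplexPaths.
Local Open Scope complex_scope.
Variable R : realType.
Local Notation C := (R[i] : numClosedFieldType).
Local Notation Re := (@complex.Re R).
Local Notation Im := (@complex.Im R).
Implicit Types (z h d : C) (f : C -> C).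

Lemma normc_realE z : `|z| = (Re `|z|)%:C.
Proof. by rewrite normc_def. Qed.

Lemma normc_real (t : R) : `|t%:C| = `|t|%:C.
Proof. by rewrite normc_def /= expr0n /= addr0 sqrtr_sqr. Qed.

Lemma Re_norm_ge0 z : 0 <= Re `|z|.
Proof. by rewrite -ler0c -normc_realE normr_ge0. Qed.

Lemma normc_ge_Im z : `|Im z|%:C <= `|z|.
Proof.
by rewrite normc_def lecR -sqrtr_sqr; apply: ler_wsqrtr; rewrite lerDr sqr_ge0.
Qed.

Lemma gt0c_real (e : C) : 0 < e -> 0 < Re e /\ e = (Re e)%:C.
Proof. by case: e => a b; rewrite ltcE /= => /andP[/eqP -> a0]. Qed.

(** The restriction of a holomorphic function to a real line has real and
    imaginary parts to which real analysis (mean value and intermediate value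
    theorems) applies. *)
Lemma is_derive_Re_path f z h d (t : R) :
  is_derive (z + t%:C * h) 1 f d ->
  is_derive t 1 (fun s : R => Re (f (z + s%:C * h))) (Re (d * h)).
Proof.
move=> /is_deriveP fd; apply/is_deriveP => e e0.
set n := Re `|h|; have n0 : 0 <= n := Re_norm_ge0 h.
have n1 : 0 < n + 1 by rewrite ltr_wpDl.
have [|r] := fd (e / (n + 1))%:C; first by rewrite ltcR divr_gt0.
move=> /gt0c_real[r0 ->] rP; exists (Re r / (n + 1)); first by rewrite divr_gt0.
move=> k kr; have := rP (k%:C * h).
have kh : `|k%:C * h| = (`|k| * n)%:C.
  by rewrite normrM normc_real [`|h|]normc_realE -rmorphM.
rewrite kh ltcR.
have kn : `|k| * n <= `|k| * (n + 1) by rewrite ler_wpM2l// lerDl.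
move=> /(_ (le_lt_trans kn _)); rewrite -ltr_pdivlMr// => /(_ kr).
have -> : k%:C * h + (z + t%:C * h) = z + (k + t)%:C * h.
  by rewrite rmorphD mulrDl addrCA.
rewrite -rmorphM; set x := (X in `|X| <= _) => xle.
have -> : Re (f (z + (k + t)%:C * h)) - Re (f (z + t%:C * h)) -
    k * Re (d * h) = Re x.
  rewrite /x -mulrA [h * d]mulrC; case: (d * h) => a b.
  by case: (f _) => ? ?; case: (f _) => ? ? /=; rewrite mul0r subr0.
rewrite -lecR; apply: (le_trans (normc_ge_Re _)); apply: (le_trans xle).
by rewrite lecR mulrAC -mulrA ler_wpM2l ?(ltW e0)// ler_pdivrMr//.
Qed.

Lemma is_derive_Im_path f z h d (t : R) :
  is_derive (z + t%:C * h) 1 f d ->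
  is_derive t 1 (fun s : R => Im (f (z + s%:C * h))) (Im (d * h)).
Proof.
move=> fd.
(* Im z = Re (- 'i z). *)
have := @is_derive_Re_path (fun x => - 'i * f x) z h (- 'i * d) t _.
have -> : (fun s : R => Re (- 'i * f (z + s%:C * h))) =
    (fun s : R => Im (f (z + s%:C * h))).
  by apply/funext => s; case: (f _) => a b /=; ring.
have -> : Re (- 'i * d * h) = Im (d * h).
  by rewrite -mulrA; case: (d * h) => a b /=; ring.
apply; have := @is_deriveZ C _ _ f (- 'i) _ _ _ fd; exact.
Qed.

Lemma constant_on_segment f z h (T : R) : 0 <= T ->
  (forall t : R, 0 <= t <= T -> is_derive (z + t%:C * h) 1 f 0) ->
  f (z + T%:C * h) = f z.
Proof.
move=> T0 fd.
have cst (g : R -> R) :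
    (forall t : R, 0 <= t <= T -> is_derive t 1 g 0) -> g T = g 0.
  move=> gd; have [| |c _] := @MVT_segment R g (fun=> 0) 0 T T0.
  - by move=> t; rewrite in_itv/= => /andP[/ltW t0 /ltW tT]; apply: gd; rewrite t0.
  - apply: derivable_within_continuous => t; rewrite in_itv/= => tT.
    by have [] := gd t tT.
  - by rewrite mul0r => /eqP; rewrite subr_eq0 => /eqP.
have /= := cst (fun s => Re (f (z + s%:C * h))).
have /= := cst (fun s => Im (f (z + s%:C * h))).
rewrite mul0r addr0 => Imf Ref.
apply/eqP; rewrite eq_complex; apply/andP; split; apply/eqP.
  by apply: Ref => t /fd/is_derive_Re_path; rewrite mul0r.
by apply: Imf => t /fd/is_derive_Im_path; rewrite mul0r.
Qed.

End ComplexPaths.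

(** * The complex exponential *)

Section ComplexExponential.
Local Open Scope complex_scope.
Variable R : realType.
Local Notation C := (R[i] : numClosedFieldType).
Local Notation Re := (@complex.Re R).
Local Notation Im := (@complex.Im R).

Definition cexp (z : C) : C :=
  (expR (Re z) * cos (Im z)) +i* (expR (Re z) * sin (Im z)).

Lemma cexp0 : cexp 0 = 1.
Proof. by rewrite /cexp /= expR0 cos0 sin0 mulr1 mulr0. Qed.

Lemma cexpD (z w : C) : cexp (z + w) = cexp z * cexp w.
Proof.
case: z w => [a b] [c d]; apply/eqP; rewrite eq_complex /=.
by rewrite expRD cosD sinD; apply/andP; split; apply/eqP; ring.
Qed.

Lemma cexpxN (z : C) : cexp z * cexp (- z) = 1.
Proof. by rewrite -cexpD subrr cexp0. Qed.

Lemma normc_le_ReIm (z : C) : `|z| <= (`|Re z| + `|Im z|)%:C.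
Proof.
rewrite normc_def lecR -[leRHS]ger0_norm ?addr_ge0// -sqrtr_sqr.
apply: ler_wsqrtr; rewrite -[Re z ^+ 2]real_normK ?num_real//.
rewrite -[Im z ^+ 2]real_normK ?num_real// sqrrD addrAC lerDl.
by rewrite mulrn_wge0// mulr_ge0.
Qed.

(** With e^a = 1 + a + E, cos b = 1 + c and sin b = b + s, every term of
    e^(a + ib) - 1 - (a + ib) contains one of the small factors E, c, s, or is
    b a. *)
Lemma cexp_remainder_le (e a b : R) : e <= 1 -> `|a| <= 1 -> `|b| <= 1 ->
  `|expR a - 1 - a| <= e * `|a| ->
  `|cos b - 1| <= e * `|b| -> `|sin b - b| <= e * `|b| ->
  `|a| <= e ->
  `|Re (cexp (a +i* b) - 1 - (a +i* b))| <= 4 * e * (`|a| + `|b|) /\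
  `|Im (cexp (a +i* b) - 1 - (a +i* b))| <= 5 * e * (`|a| + `|b|).
Proof.
move=> e1 a1 b1; set E := expR a - 1 - a; set c := cos b - 1; set s := sin b - b.
move=> Ea cb sb ae.
have e0 : 0 <= e by exact: le_trans ae.
have Ee : `|E| <= e by apply: (le_trans Ea); rewrite ler_piMr.
have -> : Re (cexp (a +i* b) - 1 - (a +i* b)) = E + c * (1 + a + E).
  by rewrite /E /c /=; ring.
have -> : Im (cexp (a +i* b) - 1 - (a +i* b)) = s * (1 + a + E) + b * (a + E).
  by rewrite /E /s /=; ring.
have n3 : `|1 + a + E| <= 3.
  apply: (le_trans (ler_normD _ _)); have := ler_normD 1 a; rewrite normr1; lra.
have n2 : `|a + E| <= 2 * e by apply: (le_trans (ler_normD _ _)); lra.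
have c3 : `|c * (1 + a + E)| <= e * `|b| * 3 by rewrite normrM ler_pM.
have s3 : `|s * (1 + a + E)| <= e * `|b| * 3 by rewrite normrM ler_pM.
have b2 : `|b * (a + E)| <= `|b| * (2 * e) by rewrite normrM ler_pM.
have ea : 0 <= e * `|a| by rewrite mulr_ge0.
have eb : 0 <= e * `|b| by rewrite mulr_ge0.
by split; apply: (le_trans (ler_normD _ _)); nra.
Qed.

Lemma is_derive_cexp (z : C) : is_derive z 1 cexp (cexp z).
Proof.
(* By the addition formula it suffices to differentiate at 0. *)
suff H : is_derive (0 : C) 1 cexp 1.
  have -> : cexp = (fun w => cexp z * cexp (w - z)).
    by apply/funext => w; rewrite -cexpD addrC subrK.
  rewrite subrr cexp0.
  have sz : is_derive z 1 (fun w : C => w - z) 1.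
    apply: is_derive_eq (addr0 _).
  have H' : is_derive (z - z) 1 cexp 1 by rewrite subrr.
  have := @is_deriveZ C _ _ _ (cexp z) _ _ _
    (@is_derive_chain C cexp (fun w : C => w - z) z 1 1 H' sz).
  by rewrite mul1r.
apply/is_deriveP => e /gt0c_real[e0 ->].
(* 18 = 2 * (4 + 5): the two parts of the remainder, and |a| + |b| <= 2 |z|. *)
pose e' := Num.min 1 (Re e / 18).
have e'0 : 0 < e' by rewrite lt_min ltr01 divr_gt0.
have e'1 : e' <= 1 by rewrite ge_min lexx.
have e'e : 18 * e' <= Re e.
  by rewrite mulrC -ler_pdivlMr// ge_min lexx orbT.
clearbody e'.
have /is_deriveP/(_ e' e'0)[r1 r10 P1] := @is_derive_expR R 0.
have /is_deriveP/(_ e' e'0)[r2 r20 P2] := @is_derive_cos R 0.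
have /is_deriveP/(_ e' e'0)[r3 r30 P3] := @is_derive_sin R 0.
pose r := Num.min e' (Num.min r1 (Num.min r2 r3)).
exists r%:C; first by rewrite ltcR /r !lt_min e'0 r10 r20.
move=> [a b] kr; rewrite addr0 cexp0 mulr1.
have ar : `|a| < r by rewrite -ltcR; exact: le_lt_trans (normc_ge_Re _) kr.
have br : `|b| < r by rewrite -ltcR; exact: le_lt_trans (normc_ge_Im _) kr.
move: (ar) (br); rewrite /r !lt_min => /and4P[ae a1 a2 a3] /and4P[be b1 b2 b3].
have := P1 a a1; have := P2 b b2; have := P3 b b3.
rewrite !addr0 expR0 cos0 sin0 oppr0 !mulr0 !mulr1 !subr0 !addr0 => Q3 Q2 Q1.
have [] := @cexp_remainder_le e' a b e'1 _ _ Q1 Q2 Q3 (ltW ae);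
  try exact: ltW (lt_le_trans _ e'1).
move=> Hre Him; apply: (le_trans (normc_le_ReIm _)).
have na : `|a| <= Re `|a +i* b|.
  by rewrite -lecR -normc_realE; exact: (normc_ge_Re (a +i* b)).
have nb : `|b| <= Re `|a +i* b|.
  by rewrite -lecR -normc_realE; exact: (normc_ge_Im (a +i* b)).
rewrite [X in _ <= _ * X]normc_realE -rmorphM lecR.
have := Re_norm_ge0 (a +i* b).
move: (Re `|a +i* b|) na nb Hre Him => n na nb Hre Him n0.
by nra.
Qed.

End ComplexExponential.

(** * Curves running off to infinity *)

Lemma first_zero (R : realType) (g : R -> R) :
  (forall t : R, 0 <= t <= 1 -> {for t, continuous g}) -> g 0 != 0 -> g 1 = 0 ->
  exists T : R, [/\ 0 < T <= 1, g T = 0 & forall t : R, 0 <= t < T -> g t != 0].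
Proof.
move=> gc g0 g1; pose S := [set t : R | 0 <= t <= 1 /\ g t = 0].
have S1 : S 1 by split; rewrite ?ler01 ?lexx.
have Slb : lbound S 0 by move=> t [/andP[]].
have iS : has_inf S by split; [exists 1|exists 0].
have T0 : 0 <= inf S by apply: lb_le_inf => //; exists 1.
have T1 : inf S <= 1 by apply: ge_inf => //; exists 0.
have gT : g (inf S) = 0.
  apply/eqP; apply/negPn/negP => gT.
  have : \forall t \near inf S, g t != 0.
    have cT : {for inf S, continuous g} by apply: gc; rewrite T0.
    apply: (cT [set x | x != 0]); apply: open_nbhs_nbhs.
    by split; [exact: open_neq|].
  move=> /nbhs_ballP[/= d d0 dP].
  have [t St tlt] := inf_adherent d0 iS.
  have le_t : inf S <= t by apply: ge_inf => //; exists 0.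
  have : g t != 0.
    by apply: dP; rewrite /ball/= distrC ger0_norm ?subr_ge0// ltrBlDl.
  by rewrite St.2 eqxx.
exists (inf S); split => //.
  rewrite T1 lt_neqAle T0 !andbT; apply: contraNneq g0 => e.
  by apply/eqP; exact: (etrans (congr1 g e) gT).
move=> t /andP[t0 tT]; apply/negP => /eqP gt0.
have : inf S <= t.
  apply: ge_inf; first by exists 0.
  by split => //; rewrite t0 (le_trans (ltW tT)).
by rewrite leNgt tT.
Qed.

(** Any power larger than the square would do below; this one follows from
    1 + a / 4 <= exp (a / 4). *)
Lemma expR_ge_pow4 (R : realType) (a : R) : 0 <= a -> a ^+ 4 / 4 ^+ 4 <= expR a.
Proof.
move=> a0; have -> : a = (a / 4) *+ 4 by rewrite -mulr_natr; field.
rewrite -{2}mulr_natr expRM_natr.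
have -> : (a / 4 *+ 4) ^+ 4 / 4 ^+ 4 = (a / 4) ^+ 4 by rewrite -mulr_natr; field.
rewrite lerXn2r ?nnegrE ?expR_ge0 ?divr_ge0//.
by apply: le_trans (expR_ge1Dx _); rewrite lerDr.
Qed.

(** The left-hand side of the last inequality is the real part of
    (p + iq) e^(ib), which changes sign when b varies by pi; an unbounded
    continuous b does vary by pi. *)
Lemma half_turn (R : realType) (b : R -> R) (s T p q : R) : s < T ->
  (forall t : R, s < t < T -> {for t, continuous b}) ->
  (forall M : R, \forall t \near T^'-, M <= `|b t|) ->
  (forall t : R, s < t < T -> p * cos (b t) - q * sin (b t) < 0) -> False.
Proof.
move=> sT bc b_oo neg.
pose t1 := (s + T) / 2.
have st1 : s < t1 by rewrite /t1; lra.
have t1T : t1 < T by rewrite /t1; lra.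
have [t2 [t12 t2T bt2]] : exists t2, [/\ t1 < t2, t2 < T & `|b t1| + 4 <= `|b t2|].
  near (T^'-) => t2; exists t2; split.
  - by near: t2; exact: nbhs_left_gt.
  - by near: t2; exact: nbhs_left_lt.
  - by near: t2; exact: b_oo.
have bc12 : {within `[t1, t2], continuous b}.
  apply/continuous_in_subspaceT => t; rewrite inE/= in_itv/= => /andP[t1t tt2].
  by apply: bc; rewrite (lt_le_trans st1)// (le_lt_trans tt2).
have ivt v : Num.min (b t1) (b t2) <= v <= Num.max (b t1) (b t2) ->
    p * cos v - q * sin v < 0.
  move=> /(IVT (ltW t12) bc12)[c]; rewrite in_itv/= => /andP[t1c ct2] <-.
  by apply: neg; rewrite (lt_le_trans st1)// (le_lt_trans ct2).
have pi4 : pi <= 4 :> R.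
  by have := @pihalf_lt2 R; lra.
have pi0 := @pi_ge0 R.
have neg1 : p * cos (b t1) - q * sin (b t1) < 0 by apply: neg; rewrite st1.
(* The half turn is taken towards the sign of b t2, which dominates b t1. *)
have [b2|b2] := leP 0 (b t2).
  have := ivt (b t1 + pi); rewrite cosDpi sinDpi ge_min le_max.
  rewrite lerDl pi0 /= => /(_ _) H.
  suff /H : (b t1 + pi <= b t1) || (b t1 + pi <= b t2) by lra.
  apply/orP; right; rewrite (ger0_norm b2) in bt2.
  by have := ler_norm (b t1); lra.
have := ivt (b t1 - pi).
rewrite -(opprK (cos (b t1 - pi))) -(opprK (sin (b t1 - pi))) -cosDpi -sinDpi subrK.
rewrite ge_min le_max => H.
suff /H : ((b t1 <= b t1 - pi) || (b t2 <= b t1 - pi)) &&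
    ((b t1 - pi <= b t1) || (b t1 - pi <= b t2)).
  by lra.
rewrite gerBl pi0 andbT; apply/orP; right.
rewrite (ltr0_norm b2) in bt2.
by have := ler_norm (- b t1); rewrite normrN; lra.
Unshelve. all: by end_near. Qed.

Section Escape.
Local Open Scope complex_scope.
Variable R : realType.
Local Notation C := (R[i] : numClosedFieldType).
Local Notation Re := (@complex.Re R).
Local Notation Im := (@complex.Im R).

Definition sqn (z : C) : R := Re z ^+ 2 + Im z ^+ 2.

Lemma sqnE (z : C) : (sqn z)%:C = `|z| ^+ 2.
Proof. exact: add_Re2_Im2. Qed.

Lemma sqn_ge0 (z : C) : 0 <= sqn z.
Proof. by rewrite addr_ge0 ?sqr_ge0. Qed.

Lemma sqnM (z w : C) : sqn (z * w) = sqn z * sqn w.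
Proof. by apply: complexI; rewrite rmorphM /= !sqnE normrM exprMn. Qed.

Lemma ler_sqn (z w : C) : (`|z| <= `|w|) = (sqn z <= sqn w).
Proof. by rewrite -(@ler_pXn2r _ 2)// ?nnegrE// -!sqnE lecR. Qed.

Lemma sqn_real (t : R) : sqn t%:C = t ^+ 2.
Proof. by rewrite /sqn /= expr0n addr0. Qed.

Lemma sqn0 : sqn (0 : C) = 0.
Proof. by rewrite /sqn /= expr0n addr0. Qed.

Lemma sqn_gt0 (z : C) : (0 < sqn z) = (z != 0).
Proof.
rewrite lt_neqAle sqn_ge0 andbT eq_sym -(inj_eq (@complexI R)) sqnE.
by rewrite sqrf_eq0 normr_eq0.
Qed.

Lemma norm_cexp (z : C) : `|cexp z| = (expR (Re z))%:C.
Proof.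
rewrite normc_def /= !exprMn -mulrDr cos2Dsin2 mulr1 sqrtr_sqr.
by rewrite ger0_norm// expR_ge0.
Qed.

(** If e^a is comparable to N and N is large, then a cannot be very negative,
    and it cannot exceed a multiple of the square root of N either, because the
    exponential grows at least like a^4. The constant 20^3 comes from
    N^2 <= 25 a^4 <= 25 * 4^4 e^a <= 25 * 4^4 * (5/4) N / q. *)
Lemma growth_bound (a N q : R) : 0 < q -> 0 <= N ->
  3 / 4 * N <= expR a * q -> expR a * q <= 5 / 4 * N ->
  20 ^+ 3 / q + 2 * q < N -> 5 * a ^+ 2 <= N.
Proof.
move=> q0 N0 lo hi Nq; rewrite leNgt; apply/negP => aN.
have q8 : 0 < 20 ^+ 3 / q by rewrite divr_gt0.
have [a0|a0] := leP 0 a.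
  have := expR_ge_pow4 a0; rewrite ler_pdivrMr// => a4.
  have N2 : N ^+ 2 <= 25 * a ^+ 4.
    have -> : 25 * a ^+ 4 = (5 * a ^+ 2) ^+ 2 by ring.
    by rewrite lerXn2r ?nnegrE// ?(ltW aN)// mulr_ge0 ?sqr_ge0.
  have : N * (N * q) <= N * 20 ^+ 3.
    have : N ^+ 2 * q <= 25 * (expR a * 4 ^+ 4) * q.
      by rewrite ler_wpM2r ?(ltW q0)//; lra.
    have -> : N ^+ 2 * q = N * (N * q) by ring.
    by lra.
  have N00 : 0 < N by lra.
  rewrite ler_pM2l// -ler_pdivlMr//; lra.
have e1 : expR a * q <= q by rewrite ler_piMl ?(ltW q0)// -expR0 ler_expR ltW.
lra.
Qed.

(** Here the real part of v is small compared with its imaginary part by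
    growth_bound, so v^2 and w lie near the negative real axis. *)
Lemma Re_cexp_lt0 (v w c : C) : c != 0 -> cexp v * c = w ->
  4 * `|w - v ^+ 2| <= `|v| ^+ 2 ->
  20 ^+ 3 / Re `|c| + 2 * Re `|c| < sqn v ->
  Re c * cos (Im v) - Im c * sin (Im v) < 0 /\ 2 * sqn v <= 4 * Im v ^+ 2.
Proof.
move=> c0 vw wv big; set q := Re `|c|.
have q0 : 0 < q by rewrite -ltcR -normc_realE normr_gt0.
set n := Re `|w - v ^+ 2|.
have n4 : 4 * n <= sqn v.
  have := wv; rewrite -sqnE [X in 4 * X]normc_realE -/n.
  have -> : 4 * n%:C = (4 * n)%:C by rewrite rmorphM /= rmorph_nat.
  by rewrite lecR.
have nw : expR (Re v) * q = Re `|w|.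
  by rewrite -vw normrM norm_cexp [`|c|]normc_realE -rmorphM.
have wle : Re `|w| <= n + sqn v.
  rewrite -lecR rmorphD /= -!normc_realE sqnE -normrX -{1}(subrK (v ^+ 2) w).
  exact: ler_normD.
have wge : sqn v <= n + Re `|w|.
  rewrite -lecR [(n + _)%:C]rmorphD /= -!normc_realE sqnE -normrX distrC.
  by rewrite -{1}(subrK w (v ^+ 2)) ler_normD.
have sv := sqn_ge0 v.
have a5 : 5 * Re v ^+ 2 <= sqn v.
  by apply: (@growth_bound _ _ q) => //; rewrite nw; lra.
have sE : sqn v = Re v ^+ 2 + Im v ^+ 2 by [].
have svpos : 0 < sqn v.
  have : 0 < 20 ^+ 3 / q by rewrite divr_gt0.
  by move: big; rewrite -/q; lra.
split; last by lra.
have Rw : Re w = expR (Re v) * (Re c * cos (Im v) - Im c * sin (Im v)).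
  by rewrite -vw; case: (c) => c1 c2 /=; ring.
suff : Re w < 0 by rewrite Rw pmulr_rlt0 ?expR_gt0.
have : Re w = Re v ^+ 2 - Im v ^+ 2 + Re (w - v ^+ 2).
  by case: (w) (v) => [w1 w2] [v1 v2] /=; ring.
have : Re (w - v ^+ 2) <= n.
  apply: (le_trans (ler_norm _)).
  by rewrite -lecR -normc_realE; exact: normc_ge_Re.
lra.
Qed.

(** Re_cexp_lt0 fixes the sign of the real part of e^v c near T, while the
    imaginary part of v is unbounded: half_turn excludes this. *)
Lemma cexp_no_escape (v w : R -> C) (c : C) (T : R) : 0 < T ->
  (forall t : R, 0 < t < T -> {for t, continuous (Im \o v)}) ->
  (forall t : R, 0 < t < T -> cexp (v t) * c = w t) ->
  (forall M : R, \forall t \near T^'-, M%:C <= `|v t|) ->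
  (\forall t \near T^'-, 4 * `|w t - v t ^+ 2| <= `|v t| ^+ 2) -> False.
Proof.
move=> T0 vc vw voo wv.
have sq_oo M : \forall t \near T^'-, M < sqn (v t).
  near=> t.
  have M0 : (0 : R) < `|M| + 1 by rewrite ltr_wpDl.
  apply: (@lt_le_trans _ _ ((`|M| + 1) ^+ 2)).
    by have := ler_norm M; have := normr_ge0 M; nra.
  rewrite -lecR sqnE rmorphXn /= lerXn2r ?nnegrE ?normr_ge0//.
    by rewrite ler0c ltW.
  by near: t; exact: voo.
(* For c = 0 one would have w = 0, which is not close to v^2. *)
have c0 : c != 0.
  apply/eqP => c0; near (T^'-) => t.
  have t0T : 0 < t < T.
    by apply/andP; split; near: t; [exact: nbhs_left_gt|exact: nbhs_left_lt].
  have s0 : 0 < sqn (v t) by near: t; exact: sq_oo.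
  have : 4 * `|w t - v t ^+ 2| <= `|v t| ^+ 2 by near: t.
  rewrite -vw// c0 mulr0 sub0r normrN normrX ger_pMl.
    by rewrite (ler_nat C 4 1).
  by rewrite -sqnE ltcR.
have [e /= e0 eP] : \forall t \near T^'-,
    Re c * cos (Im (v t)) - Im c * sin (Im (v t)) < 0 /\
    2 * sqn (v t) <= 4 * Im (v t) ^+ 2.
  near=> t.
  have t0T : 0 < t < T.
    by apply/andP; split; near: t; [exact: nbhs_left_gt|exact: nbhs_left_lt].
  apply: (Re_cexp_lt0 c0 (vw t t0T)); first by near: t.
  by near: t; exact: sq_oo.
pose s := Num.max 0 (T - e).
have inI t : s < t < T -> 0 < t < T /\ ball_ (fun x => `|x|) T e t.
  rewrite gt_max -andbA => /and3P[t0 te tT]; rewrite t0 tT; split => //.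
  by rewrite /ball_ /= ger0_norm ?subr_ge0 ?(ltW tT)//; lra.
have sT : s < T by rewrite gt_max T0 gtrBl.
apply: (@half_turn R (Im \o v) s T (Re c) (Im c)).
- exact: sT.
- by move=> t /inI[t0T _]; exact: vc.
- move=> M; near=> t.
  have [_ bt] : Re c * cos (Im (v t)) - Im c * sin (Im (v t)) < 0 /\
      2 * sqn (v t) <= 4 * Im (v t) ^+ 2.
    have /inI[/andP[_ tT] tb] : s < t < T.
      by apply/andP; split; near: t; [exact: nbhs_left_gt|exact: nbhs_left_lt].
    exact: eP.
  have M2 : 2 * M ^+ 2 < sqn (v t) by near: t; exact: sq_oo.
  have [M0|M0] := leP 0 M; last exact: ltW (lt_le_trans M0 _).
  rewrite -(@ler_pXn2r _ 2)// ?nnegrE// real_normK ?num_real//=.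
  by lra.
- move=> t /inI[/andP[t0 tT] tb]; by have [] := eP t tb tT.
Unshelve. all: by end_near. Qed.

End Escape.

(** * Charts of the projective plane *)

Section Charts.
Variable K : numClosedFieldType.
Implicit Types (v : 'rV[K]_3) (u : 'rV[K]_2) (k i : 'I_3).

Definition affine_coords k v : 'rV[K]_2 := \row_j (v 0 (lift k j) / v 0 k).

Lemma chart_vec_k k u : chart_vec k u 0 k = 1.
Proof. by rewrite mxE unlift_none. Qed.

Lemma chart_vec_lift k u j : chart_vec k u 0 (lift k j) = u 0 j.
Proof. by rewrite mxE liftK. Qed.

Lemma chart_vec_affine k v : v 0 k != 0 ->
  v = v 0 k *: chart_vec k (affine_coords k v).
Proof.
move=> vk; apply/rowP => i; rewrite mxE.
case: (unliftP k i) => [j ->|->]; last by rewrite chart_vec_k mulr1.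
by rewrite chart_vec_lift mxE mulrC divfK.
Qed.

Lemma affine_coordsZ k (c : K) v : c != 0 ->
  affine_coords k (c *: v) = affine_coords k v.
Proof.
by move=> c0; apply/rowP => j; rewrite !mxE -mulf_div divff// mul1r.
Qed.

Lemma chart_vecK k : cancel (@chart_vec K k) (affine_coords k).
Proof.
by move=> u; apply/rowP => j; rewrite mxE chart_vec_k chart_vec_lift divr1.
Qed.

Lemma chart_eqP k k' u u' :
  chart k u = chart k' u' <->
  exists2 c : K, c != 0 & chart_vec k u = c *: chart_vec k' u'.
Proof.
split=> [/(congr1 sval)/= e|[c c0 e]].
  have : chart_vec k u \in <[chart_vec k' u']>%VS by rewrite -e memv_line.
  move=> /vlineP[c ce]; exists c => //; apply/eqP => c0.
  have := chart_vec_k k u; rewrite ce c0 scale0r mxE => /eqP.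
  by rewrite eq_sym oner_eq0.
apply: val_inj => /=; rewrite e; apply/eqP; rewrite eqEsubv -!memvE.
rewrite memvZ ?memv_line//=.
by rewrite -{1}[chart_vec k' u']scale1r -(mulVf c0) -scalerA memvZ ?memv_line.
Qed.

Lemma chart_change k k' u : chart_vec k u 0 k' != 0 ->
  chart k u = chart k' (affine_coords k' (chart_vec k u)).
Proof.
move=> h; apply/chart_eqP; exists (chart_vec k u 0 k') => //.
exact: chart_vec_affine.
Qed.

Lemma in_some_chart (p : proj_plane K) : exists k u, p = chart k u.
Proof.
case: p => l dl; pose v := vpick l.
have v0 : v != 0 by rewrite vpick0 -dimv_eq0 (eqP dl).
have [k vk] : exists k, v 0 k != 0.
  apply/existsP; apply: contraNT v0; rewrite negb_exists => /forallP v0.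
  by apply/eqP/rowP => i; have /negPn/eqP := v0 i; rewrite mxE.
exists k, (affine_coords k v); apply: val_inj => /=.
apply/eqP; rewrite eq_sym eqEdim -memvE (eqP dl) (eqP (dim_chart_vec _ _)) andbT.
have e := chart_vec_affine vk.
have -> : chart_vec k (affine_coords k v) = (v 0 k)^-1 *: v.
  by rewrite -[LHS]scale1r -(mulVf vk) -scalerA -e.
by rewrite memvZ// memv_pick.
Qed.

Variables (N : nat) (F : foliation K N).

Definition coef_at v i : K := mpoly.meval (v 0) (F 0 i).

Lemma coef_atZ (c : K) v i : coef_at (c *: v) i = c ^+ N.+1 * coef_at v i.
Proof.
rewrite /coef_at !mpoly.mevalE mulr_sumr.
rewrite big_seq [in RHS]big_seq; apply: eq_bigr => m.
move=> /(mpoly.dhomog_mf (foliation_homog F i)) dm.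
rewrite mulrCA; congr (_ * _).
under eq_bigr do rewrite mxE exprMn.
by rewrite big_split /= prodrXr -mpoly.mdegE dm.
Qed.

Lemma coef_at_radial v : \sum_i coef_at v i * v 0 i = 0.
Proof.
rewrite -[RHS](mpoly.meval0 (v 0)) -(foliation_radial F) rmorph_sum /=.
by apply: eq_bigr => i _; rewrite rmorphM /= mpoly.mevalXU.
Qed.

Lemma singular_chart k u :
  singular F (chart k u) <-> forall i, coef_at (chart_vec k u) i = 0.
Proof.
split=> [sing i|z v /vlineP[c ->] i]; first exact/sing/memv_line.
by rewrite -/(coef_at _ _) coef_atZ z mulr0.
Qed.

(** The default 0 is the derivative of the coordinate normalised to 1. *)
Definition chart_velocity k (du : 'rV[K]_2) : 'rV[K]_3 :=
  \row_i oapp (du 0) 0 (unlift k i).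

(** In homogeneous coordinates the form looks the same in all charts, because
    the velocity has no component along the coordinate normalised to 1. *)
Lemma form_at_chart k u du :
  form_at (chart_form k F) u du =
  \sum_i coef_at (chart_vec k u) i * chart_velocity k du 0 i.
Proof.
rewrite (bigD1_ord k)//= mxE unlift_none /= mulr0 add0r.
apply: eq_bigr => j _; rewrite [chart_velocity _ _ _ _]mxE liftK mxE; congr (_ * _).
rewrite mpoly.comp_mpoly_meval; apply: mpoly.meval_eq => i.
rewrite tnth_mktuple mxE; case: (unlift k i) => [j'|] /=.
  by rewrite mpoly.mevalXU.
by rewrite mpoly.meval1.
Qed.

(** Among monomials of a fixed degree, the exponent of the variable set to 1 is
    determined by the other exponents. *)
Lemma dehomogenize_inj (p : mpoly.mpoly 3 K) k d :
  p \is mpoly.ishomog1 d (@mpoly.mdeg 3) ->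
  mpoly.comp_mpoly [tuple oapp (@mvar K 2) 1 (unlift k i) | i < 3] p = 0 ->
  p = 0.
Proof.
set lq := (X in mpoly.comp_mpoly X) => hp p0.
pose del (m : mpoly.multinom 3) : mpoly.multinom 2 :=
  mpoly.Multinom [tuple m (lift k j) | j < 2].
have delE m j : del m j = m (lift k j) by rewrite mpoly.multinomE tnth_mktuple.
have Xdel m : mpoly.comp_mpoly lq (mpoly.mpolyX K m) = mpoly.mpolyX K (del m).
  rewrite mpoly.comp_mpolyX (bigD1_ord k)//= tnth_mktuple unlift_none expr1n mul1r.
  rewrite mpoly.mpolyXE_id; apply: eq_bigr => j _.
  by rewrite tnth_mktuple liftK delE.
have del_inj m m' : mpoly.mdeg m = d -> mpoly.mdeg m' = d ->
    del m = del m' -> m = m'.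
  rewrite !mpoly.mdegE !(bigD1_ord k)//= => dm dm' e.
  have ej j : m (lift k j) = m' (lift k j) by rewrite -!delE e.
  apply/mpoly.mnmP => i; case: (unliftP k i) => [j ->//|->].
  by move: dm'; rewrite -dm; under eq_bigr do rewrite -ej; move/addIn.
apply/mpoly.mpolyP => m; rewrite mpoly.mcoeff0.
have [dm|dm] := eqVneq (mpoly.mdeg m) d; last exact: mpoly.dhomog_nemf_coeff hp dm.
apply/eqP/negPn/negP => pm.
have : mpoly.mcoeff (del m) (mpoly.comp_mpoly lq p) = 0 by rewrite p0 mpoly.mcoeff0.
have mp : m \in mpoly.msupp p by rewrite mpoly.mcoeff_msupp.
rewrite mpoly.comp_mpolyEX raddf_sum /= (bigD1_seq m mp (mpoly.msupp_uniq p))/=.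
rewrite Xdel mpoly.mcoeffZ mpoly.mcoeffX eqxx mulr1 big_seq_cond big1 ?addr0.
  by move/eqP; rewrite (negPf pm).
move=> m' /andP[m'p m'm]; rewrite Xdel mpoly.mcoeffZ mpoly.mcoeffX.
case: eqP => [/del_inj e|_]; last by rewrite mulr0.
by move: m'm; rewrite e ?eqxx// (mpoly.dhomog_mf hp).
Qed.

End Charts.

(** The first two coefficients are recovered by homogenization, the third one
    from the radial relation, as the last variable is not a zero divisor. *)
Lemma foliation_coefs (K : numClosedFieldType) (F : foliation K 2)
    (w : one_form K 2) (a b c : mpoly.mpoly 3 K) :
  described_in_chart F ord_max w ->
  a \is mpoly.ishomog1 3 (@mpoly.mdeg 3) ->
  b \is mpoly.ishomog1 3 (@mpoly.mdeg 3) ->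
  mpoly.comp_mpoly [tuple mvar K 0; mvar K 1; 1] a = w 0 0 ->
  mpoly.comp_mpoly [tuple mvar K 0; mvar K 1; 1] b = w 0 1 ->
  a * mvar K 0 + b * mvar K 1 + c * mvar K ord_max = 0 ->
  exists k : K, [/\ k != 0, F 0 0 = k *: a, F 0 1 = k *: b & F 0 ord_max = k *: c].
Proof.
move=> [k k0 Fw] ha hb wa wb rad; exists k.
have l0 : lift ord_max 0 = 0 :> 'I_3 by exact/val_inj.
have l1 : lift ord_max 1 = 1 :> 'I_3 by exact/val_inj.
have lqE : [tuple oapp (@mvar K 2) 1 (unlift ord_max i) | i < 3] =
    [tuple mvar K 0; mvar K 1; 1].
  apply: eq_from_tnth; apply: ord3_ind; rewrite tnth_mktuple.
  - by rewrite -l0 liftK.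
  - by rewrite -l1 liftK.
  - by rewrite unlift_none.
have dehom (i : 'I_2) p : p \is mpoly.ishomog1 3 (@mpoly.mdeg 3) ->
    mpoly.comp_mpoly [tuple mvar K 0; mvar K 1; 1] p = w 0 i ->
    F 0 (lift ord_max i) = k *: p.
  move=> hp pw; apply/eqP; rewrite -subr_eq0; apply/eqP.
  apply: (@dehomogenize_inj K _ ord_max 3).
    by rewrite rpredB ?foliation_homog// rpredZ.
  rewrite lqE mpoly.comp_mpolyB mpoly.comp_mpolyZ pw.
  move/rowP/(_ i): Fw; rewrite !mxE lqE => ->.
  by rewrite mpoly.mul_mpolyC subrr.
have F0 : F 0 0 = k *: a by rewrite -(dehom 0)// l0.
have F1 : F 0 1 = k *: b by rewrite -(dehom 1)// l1.
split => //.
have Z0 : mvar K (ord_max : 'I_3) != 0.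
  by have := mvarXn_neq0 K ord_max 1; rewrite expr1.
apply: (mulIf Z0).
have := foliation_radial F; rewrite !big_ord_recl big_ord0 /=.
have -> : lift ord0 ord0 = 1 :> 'I_3 by exact/val_inj.
have -> : lift ord0 (lift ord0 ord0) = ord_max :> 'I_3 by exact/val_inj.
rewrite addr0 F0 F1 => e.
have : k *: (a * mvar K 0 + b * mvar K 1 + c * mvar K ord_max) = 0.
  by rewrite rad scaler0.
by rewrite !scalerDr !scalerAl -[in RHS]e -addrA => /addrI/addrI ->.
Qed.

Lemma is_derive_quotient (K : numFieldType) (f g : K -> K) (s df dg : K) :
  is_derive s 1 f df -> is_derive s 1 g dg -> g s != 0 ->
  is_derive s 1 (fun t => f t / g t) ((df * g s - f s * dg) / g s ^+ 2).
Proof.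
move=> Df Dg g0.
have Dgi : is_derive s 1 (fun t => (g t)^-1) (- (g s) ^- 2 *: dg).
  have [dg1 dg2] := Dg.
  by split; [exact: derivableV|rewrite deriveV// dg2].
have [D1 D2] := is_deriveM Df Dgi; split => //.
rewrite (_ : (fun t => f t / g t) = f * (fun t => (g t)^-1))// D2.
by rewrite /GRing.scale/=; field.
Qed.

Lemma is_derive_chart_vec (K : numClosedFieldType) (k i : 'I_3)
    (g : K -> 'rV[K]_2) (s : K) d :
  is_derive s 1 g d ->
  is_derive s 1 (fun t => chart_vec k (g t) 0 i) (chart_velocity k d 0 i).
Proof.
move=> /is_derive_rowP gd; rewrite mxE.
under eq_fun do rewrite mxE.
by case: (unlift k i) => [j|] /=; [exact: gd|exact: is_derive_cst].
Qed.

Lemma is_derive_affine (K : numClosedFieldType) (k l : 'I_3)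
    (g : K -> 'rV[K]_2) (s : K) d :
  is_derive s 1 g d -> chart_vec k (g s) 0 l != 0 ->
  is_derive s 1 (fun t => affine_coords l (chart_vec k (g t)))
    (\row_j ((chart_velocity k d 0 (lift l j) * chart_vec k (g s) 0 l
      - chart_vec k (g s) 0 (lift l j) * chart_velocity k d 0 l)
      / chart_vec k (g s) 0 l ^+ 2)).
Proof.
move=> gd v0; apply/is_derive_rowP => j; rewrite [X in is_derive _ _ _ X]mxE.
under eq_fun do rewrite mxE.
by apply: is_derive_quotient => //; exact: is_derive_chart_vec.
Qed.

(** Passing to the chart [l] divides by a function q; the terms with the
    derivative of q cancel by the radial relation. *)
Lemma tangent_affine (K : numClosedFieldType) (N : nat) (F : foliation K N)
    (k l : 'I_3) (u d : 'rV[K]_2) :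
  chart_vec k u 0 l != 0 -> form_at (chart_form k F) u d = 0 ->
  form_at (chart_form l F) (affine_coords l (chart_vec k u))
    (\row_j ((chart_velocity k d 0 (lift l j) * chart_vec k u 0 l
      - chart_vec k u 0 (lift l j) * chart_velocity k d 0 l)
      / chart_vec k u 0 l ^+ 2)) = 0.
Proof.
rewrite !form_at_chart; set v := chart_vec k u; set dv := chart_velocity k d.
move=> v0 tan; set D := \row_j _; set q := v 0 l.
have rad := coef_at_radial F v.
have cE i : coef_at F v i =
    q ^+ N.+1 * coef_at F (chart_vec l (affine_coords l v)) i.
  by rewrite -coef_atZ -chart_vec_affine.
have vq i : chart_velocity l D 0 i = (dv 0 i * q - v 0 i * dv 0 l) / q ^+ 2.
  rewrite mxE; case: (unliftP l i) => [j ->|->]; first by rewrite /= mxE.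
  by rewrite /= [dv 0 l * q]mulrC subrr mul0r.
have qN : q ^+ N.+1 != 0 by rewrite expf_neq0.
apply: (mulfI qN); rewrite mulr0 mulr_sumr.
under eq_bigr do rewrite mulrA -cE vq mulrA mulrBr mulrDl.
rewrite big_split /=.
have -> : \sum_i coef_at F v i * (dv 0 i * q) / q ^+ 2 =
    (\sum_i coef_at F v i * dv 0 i) * (q / q ^+ 2).
  by rewrite mulr_suml; apply: eq_bigr => i _; rewrite !mulrA.
rewrite tan mul0r add0r.
have -> : \sum_i - (coef_at F v i * (v 0 i * dv 0 l)) / q ^+ 2 =
    (\sum_i coef_at F v i * v 0 i) * (- dv 0 l / q ^+ 2).
  by rewrite mulr_suml; apply: eq_bigr => i _; rewrite mulNr !mulrA mulrN mulNr.
by rewrite rad mul0r.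
Qed.

(** * Integral discs and the line at infinity *)

Lemma is_derive_continuous (R : realType) (f : R -> R) (x d : R) :
  is_derive x 1 f d -> {for x, continuous f}.
Proof. by move=> [/derivable1_diffP/differentiable_continuous]. Qed.

Section IntegralDiscs.
Local Open Scope complex_scope.
Variable R : realType.
Local Notation C := (R[i] : numClosedFieldType).
Local Notation Re := (@complex.Re R).
Local Notation Im := (@complex.Im R).

(** Both conclusions of the theorem are drawn from this data, for a field V in
    the chart X = 1 whose orbits are the level sets of H. The last clause says
    that a level set of H reaches the line X = 0 only at its point with Y = 0:
    going to X = 0 elsewhere means that Y/X is unbounded and Z/Y is bounded. *)
Record solvable_foliation (F : foliation C 2) (V : vector_field C)
    (H : 'rV[C]_2 -> C) : Prop := SolvableFoliation {
  line_at_infinity : forall v : 'rV[C]_3, v 0 0 = 0 ->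
    [/\ coef_at F v 0 = 0 <-> v 0 1 = 0, coef_at F v 1 = 0 &
        coef_at F v ord_max = 0];
  affine_regular : forall u, exists i, coef_at F (chart_vec ord0 u) i != 0;
  field_neq0 : forall u, field_at V u != 0;
  field_tangent : \sum_j chart_form ord0 F 0 j * V 0 j = 0;
  field_flow : forall u, exists g : C -> 'rV[C]_2,
    [/\ g 0 = u, forall s : C, is_derive s 1 g (field_at V (g s)) &
        forall u', H u' = H u -> exists s, g s = u'];
  first_integral : forall (g : C -> 'rV[C]_2) (s : C) d, is_derive s 1 g d ->
    form_at (chart_form ord0 F) (g s) d = 0 -> is_derive s 1 (H \o g) 0;
  no_escape : forall (u : R -> 'rV[C]_2) (c : C) (T : R), 0 < T ->
    (forall (t : R) j, 0 < t < T -> {for t, continuous (fun r => Re (u r 0 j))} /\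
                              {for t, continuous (fun r => Im (u r 0 j))}) ->
    (forall t : R, 0 < t < T -> H (u t) = c) ->
    (forall M : R, \forall t \near T^'-, M%:C <= `|u t 0 0|) ->
    (exists B : R, \forall t \near T^'-, `|u t 0 1| <= B%:C * `|u t 0 0|) ->
    False }.

Variables (F : foliation C 2) (V : vector_field C) (H : 'rV[C]_2 -> C).
Hypothesis sF : solvable_foliation F V H.

Lemma regular_at_infinity (k : 'I_3) (u : 'rV[C]_2) :
  chart_vec k u 0 0 = 0 -> ~ singular F (chart k u) -> chart_vec k u 0 1 != 0.
Proof.
move=> u0 ns; apply/eqP => u1; apply: ns; apply/singular_chart.
have [[_ c0] c1 c2] := line_at_infinity sF u0.
by apply: ord3_ind; rewrite // c0.
Qed.

Lemma disc_convex (s t : C) (r : R) : `|s| < 1 -> `|t| < 1 -> 0 <= r <= 1 ->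
  `|s + r%:C * (t - s)| < 1.
Proof.
move=> s1 t1 /andP[r0 r1].
have -> : s + r%:C * (t - s) = (1 - r)%:C * s + r%:C * t.
  by rewrite rmorphB rmorph1; ring.
apply: (le_lt_trans (ler_normD _ _)); rewrite !normrM !normc_real.
rewrite (ger0_norm r0) (@ger0_norm _ (1 - r)) ?subr_ge0//.
rewrite [`|s|]normc_realE [`|t|]normc_realE.
rewrite -!rmorphM -rmorphD ltcR.
move: s1 t1; rewrite [`|s|]normc_realE [`|t|]normc_realE !ltcR => s1 t1.
have [r00|r00] := eqVneq r 0; first by rewrite r00 subr0 mul1r mul0r addr0.
have rp : 0 < r by rewrite lt_neqAle eq_sym r00.
by nra.
Qed.

Section Disc.
Variables (k : 'I_3) (g : C -> 'rV[C]_2).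
Hypothesis disc : integral_disc F k g.
Let v (s : C) := chart_vec k (g s).
Let y (s : C) := affine_coords ord0 (v s).

Lemma is_derive_disc (s : C) : `|s| < 1 -> is_derive s 1 g (derive1 g s).
Proof. by move=> /disc[dg _ _ _]; rewrite derive1E; exact: derivableP. Qed.

Lemma is_derive_first_integral (s : C) : `|s| < 1 -> v s 0 0 != 0 ->
  is_derive s 1 (fun t => H (y t)) 0.
Proof.
move=> s1 v0; have [_ _ _ tan] := disc s1.
exact: (first_integral sF (is_derive_affine (is_derive_disc s1) v0)
  (tangent_affine v0 tan)).
Qed.

Lemma first_integral_segment (s t : C) (r : R) :
  `|s| < 1 -> `|t| < 1 -> 0 <= r <= 1 ->
  (forall q : R, 0 <= q <= r -> v (s + q%:C * (t - s)) 0 0 != 0) ->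
  H (y (s + r%:C * (t - s))) = H (y s).
Proof.
move=> s1 t1 /andP[r0 r1] v0.
apply: (@constant_on_segment R (fun t => H (y t))) => // q q01.
apply: is_derive_first_integral; last exact: v0.
by apply: disc_convex => //; case/andP: q01 => -> /le_trans->.
Qed.

Lemma continuous_disc (z h : C) (i : 'I_3) (t : R) : `|z + t%:C * h| < 1 ->
  {for t, continuous (fun r : R => Re (v (z + r%:C * h) 0 i))} /\
  {for t, continuous (fun r : R => Im (v (z + r%:C * h) 0 i))}.
Proof.
move=> zt; have D := is_derive_chart_vec k i (is_derive_disc zt).
by split; [have /is_derive_continuous := is_derive_Re_path D
          |have /is_derive_continuous := is_derive_Im_path D].
Qed.

Lemma continuous_disc_sqn (z h : C) (i : 'I_3) (t : R) : `|z + t%:C * h| < 1 ->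
  {for t, continuous (fun r : R => sqn (v (z + r%:C * h) 0 i))}.
Proof.
move=> /(@continuous_disc z h i)[c1 c2].
exact: (continuousD (continuousM c1 c1) (continuousM c2 c2)).
Qed.

(** Otherwise let p T be the first point with X = 0 on the segment from s to t.
    Since Y does not vanish there, the part of the segment before p T is a curve
    excluded by no_escape. *)
Lemma disc_avoids_infinity (s t : C) : `|s| < 1 -> `|t| < 1 ->
  v s 0 0 != 0 -> v t 0 0 != 0.
Proof.
move=> s1 t1 vs; apply/negP => /eqP vt.
pose p (r : R) := s + r%:C * (t - s).
have p1 (r : R) : 0 <= r <= 1 -> `|p r| < 1 by exact: disc_convex.
have [| | |T [/andP[T0 T1] gT gt]] := @first_zero R (fun r => sqn (v (p r) 0 0)).
- by move=> r /p1; exact: continuous_disc_sqn.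
- by rewrite /p mul0r addr0 -(inj_eq (@complexI R)) sqnE expf_neq0// normr_eq0.
- by rewrite /p rmorph1 mul1r subrKC vt sqn0.
have vT : v (p T) 0 0 = 0.
  apply/eqP; rewrite -normr_eq0 -sqrf_eq0 -sqnE.
  by rewrite gT.
have vp (r : R) : 0 <= r < T -> v (p r) 0 0 != 0.
  by move=> /gt; apply: contra_neq => ->; rewrite sqn0.
have pT1 : `|p T| < 1 by apply: p1; rewrite T1 ltW.
have [_ _ ns _] := disc pT1.
have v1 : v (p T) 0 1 != 0 by exact: regular_at_infinity.
have near_T i (P : set R) : nbhs (sqn (v (p T) 0 i)) P ->
    \forall r \near T^'-, P (sqn (v (p r) 0 i)).
  move=> nP; have cT := @continuous_disc_sqn s (t - s) i T pT1.
  by apply: (cvg_at_left_filter cT).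
have inT (r : R) : 0 < r < T -> [/\ `|p r| < 1, v (p r) 0 0 != 0 & 0 <= r <= 1].
  move=> /andP[r0 rT]; have r01 : 0 <= r <= 1.
    by rewrite ltW//= ltW// (lt_le_trans rT).
  by split => //; [exact: p1|apply: vp; rewrite (ltW r0)].
have yE (r : R) (j : 'I_2) :
    y (p r) 0 j = v (p r) 0 (lift ord0 j) / v (p r) 0 0.
  by rewrite mxE.
have l0 : lift ord0 (0 : 'I_2) = 1 by exact/val_inj.
have l1 : lift ord0 (1 : 'I_2) = ord_max by exact/val_inj.
pose a := sqn (v (p T) 0 1) / 2.
have a0 : 0 < a by rewrite divr_gt0// sqn_gt0.
apply: (no_escape sF (u := y \o p) (c := H (y s)) T0).
- move=> t' j /inT[pt vt' _].
  have /is_derive_rowP/(_ j) D := is_derive_affine (is_derive_disc pt) vt'.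
  by split; [have /is_derive_continuous := is_derive_Re_path D
            |have /is_derive_continuous := is_derive_Im_path D].
- move=> r rT; have [_ _ r01] := inT r rT; apply: first_integral_segment => //.
  move=> q /andP[q0 qr]; apply: vp; rewrite q0 (le_lt_trans qr)//.
  by case/andP: rT.
- move=> M; have M2 : 0 < M ^+ 2 + 1 by rewrite ltr_wpDl// sqr_ge0.
  near=> r.
  have rT : 0 < r < T.
    by apply/andP; split; near: r; [exact: nbhs_left_gt|exact: nbhs_left_lt].
  have [_ v0 _] := inT r rT.
  have M1 : M%:C <= `|M|%:C by rewrite lecR ler_norm.
  apply: (le_trans M1); rewrite -normc_real ler_sqn sqn_real yE l0.
  have v0' : 0 < sqn (v (p r) 0 0) by rewrite sqn_gt0.
  rewrite -(ler_pM2r v0') -sqnM divfK//.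
  apply: (@le_trans _ _ a); last first.
    apply: ltW; near: r; apply: (near_T _ [set x | a < x]); apply: lt_nbhsr.
    by rewrite /a ltr_pdivrMr// ltr_pMr ?ltr1n// sqn_gt0.
  have s0 : sqn (v (p r) 0 0) < a / (M ^+ 2 + 1).
    near: r; apply: (near_T _ [set x | x < a / (M ^+ 2 + 1)]); apply: lt_nbhsl.
    by rewrite vT sqn0 divr_gt0.
  rewrite ltr_pdivlMr// in s0; apply: (le_trans _ (ltW s0)).
  by rewrite mulrC ler_wpM2l ?(ltW v0')// lerDl.
- pose b := sqn (v (p T) 0 ord_max) + 1.
  have b0 : 0 < b by rewrite ltr_wpDl// sqn_ge0.
  exists (b / a + 1); near=> r.
  have rT : 0 < r < T.
    by apply/andP; split; near: r; [exact: nbhs_left_gt|exact: nbhs_left_lt].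
  have [_ v0 _] := inT r rT.
  have v0' : 0 < sqn (v (p r) 0 0) by rewrite sqn_gt0.
  have ba0 : 0 < b / a by rewrite divr_gt0.
  have -> : (b / a + 1)%:C = `|(b / a + 1)%:C|.
    by rewrite normc_real ger0_norm// ltW// ltr_wpDr.
  rewrite -normrM ler_sqn sqnM sqn_real !yE l0 l1.
  rewrite -(ler_pM2r v0') -mulrA -!sqnM !divfK//.
  have vb : sqn (v (p r) 0 ord_max) < b.
    near: r; apply: (near_T _ [set x | x < b]); apply: lt_nbhsl.
    by rewrite /b ltrDl.
  have va : a < sqn (v (p r) 0 1).
    near: r; apply: (near_T _ [set x | a < x]); apply: lt_nbhsr.
    by rewrite /a ltr_pdivrMr// ltr_pMr ?ltr1n// sqn_gt0.
  apply: (le_trans (ltW vb)).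
  rewrite -[leLHS](@divfK _ a) ?gt_eqF//.
  apply: ler_pM => //; [exact: ltW|exact: ltW| |exact: ltW].
  by move: (b / a) ba0 => q q0; nra.
Unshelve. all: by end_near. Qed.

Lemma disc_leaf (s t : C) : `|s| < 1 -> `|t| < 1 -> v s 0 0 != 0 ->
  v t 0 0 != 0 /\ H (y t) = H (y s).
Proof.
move=> s1 t1 vs; split; first exact: disc_avoids_infinity vs.
have := @first_integral_segment s t 1 s1 t1.
rewrite rmorph1 mul1r subrKC; apply; first by rewrite ler01 lexx.
move=> q q01; apply: disc_avoids_infinity vs => //.
exact: disc_convex.
Qed.


End Disc.
End IntegralDiscs.

(** * Leaves as level sets *)

Lemma form_atZ (K : numClosedFieldType) n (w : one_form K n)
    (u v : 'rV[K]_n) (r : K) :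
  form_at w u (r *: v) = r * form_at w u v.
Proof.
rewrite /form_at mulr_sumr; apply: eq_bigr => i _.
by rewrite [LHS]mulrC mxE mulrAC mulrA.
Qed.

Lemma leaf_subset (K : numClosedFieldType) (N : nat) (F : foliation K N)
    (m : proj_plane K) (S : set (proj_plane K)) : S m ->
  (forall k g (s t : K), integral_disc F k g -> `|s| < 1 -> `|t| < 1 ->
    S (chart k (g s)) -> S (chart k (g t))) ->
  leaf F m `<=` S.
Proof.
move=> Sm step p mp.
suff imp x z : Relation_Operators.clos_trans _ (same_plaque F) x z ->
    S x -> S z.
  exact: imp mp Sm.
elim=> [{}x {}z [k [g [s [t [disc s1 t1 -> ->]]]]]|x1 x2 x3 _ H1 _ H2 /H1/H2//].
exact: step.
Qed.

(** Rescaling the time turns any bounded piece of an entire integral curve into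
    an integral disc, so one plaque joins two given points of the curve. *)
Lemma range_subset_leaf (K : numClosedFieldType) (N : nat) (F : foliation K N)
    (k : 'I_3) (g dg : K -> 'rV[K]_2) :
  (forall s : K, is_derive s 1 g (dg s)) -> (forall s, dg s != 0) ->
  (forall s, ~ singular F (chart k (g s))) ->
  (forall s, form_at (chart_form k F) (g s) (dg s) = 0) ->
  range (fun s : K => chart k (g s)) `<=` leaf F (chart k (g 0)).
Proof.
move=> gd dg0 ns tan _ [s _ <-].
(* The disc t |-> g (r t) contains the parameters 0 and s / r. *)
pose r : K := `|s| + 1; have r0 : 0 < r by rewrite ltr_wpDl.
have disc : integral_disc F k (fun t => g (r * t)).
  move=> t _; have D : is_derive t 1 (fun t => g (r * t)) (r *: dg (r * t)).
    apply/is_derive_rowP => j; rewrite mxE mulrC.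
    have /is_derive_rowP/(_ j) Dj := gd (r * t).
    have Dr : is_derive t 1 (fun t : K => r * t) r.
      by have := is_deriveZ r (is_derive_id t 1); rewrite /GRing.scale/= mulr1.
    exact: (@is_derive_chain K (fun t => g t 0 j) (fun t : K => r * t) t _ _ Dj Dr).
  have [D1 D2] := D; rewrite derive1E D2.
  split => //; first by rewrite scaler_eq0 gt_eqF//= dg0.
  by rewrite form_atZ tan mulr0.
apply: Relation_Operators.t_step; exists k, (fun t => g (r * t)), 0, (s / r).
rewrite mulr0 [r * _]mulrC divfK ?gt_eqF//; split; rewrite // ?normr0//.
by rewrite normrM normfV (gtr0_norm r0) ltr_pdivrMr// mul1r ltrDl.
Qed.

Section LevelSets.
Local Open Scope complex_scope.
Variable R : realType.
Local Notation C := (R[i] : numClosedFieldType).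
Variables (F : foliation C 2) (V : vector_field C) (H : 'rV[C]_2 -> C).
Hypothesis sF : solvable_foliation F V H.

(** The first integral is constant along the orbit of u and along integral
    discs, so the leaf is contained in a level set, which is the orbit of u. *)
Lemma entire_affine_leaf (u : 'rV[C]_2) : entire_curve (leaf F (chart ord0 u)).
Proof.
have [g [g0 gd lvl]] := field_flow sF u.
exists ord0, g; split; first by move=> s; have [] := gd s.
have tan s : form_at (chart_form ord0 F) (g s) (field_at V (g s)) = 0.
  rewrite -[RHS](mpoly.meval0 (g s 0)) -(field_tangent sF) rmorph_sum /=.
  by apply: eq_bigr => j _; rewrite rmorphM /= [field_at _ _ _ _]mxE.
have Hg (s : C) : H (g s) = H u.
  have := @constant_on_segment R (H \o g) 0 s 1 ler01.
  rewrite /= rmorph1 mul1r add0r g0.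
  by apply=> t _; exact: (first_integral sF (gd _) (tan _)).
rewrite -g0; apply/seteqP; split.
  apply: leaf_subset; first by exists 0.
  move=> k f s t disc s1 t1 [r _ /chart_eqP[c c0 e]].
  have vs : chart_vec k (f s) = c^-1 *: chart_vec ord0 (g r).
    by rewrite e scalerA mulVf// scale1r.
  have vs0 : chart_vec k (f s) 0 0 != 0.
    by rewrite vs mxE (chart_vec_k ord0) mulr1 invr_neq0.
  have [vt0 Ht] := disc_leaf sF disc s1 t1 vs0.
  rewrite vs affine_coordsZ ?invr_neq0// chart_vecK Hg in Ht.
  have [q gq] := lvl _ Ht; exists q => //.
  by rewrite gq -chart_change.
apply: (range_subset_leaf gd) => // s; first exact: (field_neq0 sF).
move=> /singular_chart sg; have [l] := affine_regular sF (g s).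
by rewrite sg eqxx.
Qed.

(** By disc_leaf read backwards, a disc meeting the line X = 0 is contained in
    it; the regular points of this line form the affine line u + s e. *)
Lemma entire_leaf_at_infinity (u : 'rV[C]_2) :
  u 0 0 = 0 -> entire_curve (leaf F (chart 1 u)).
Proof.
move=> u0; have l0 : lift 1 0 = 0 :> 'I_3 by exact/val_inj.
have l1 : lift 1 1 = ord_max :> 'I_3 by exact/val_inj.
pose e : 'rV[C]_2 := delta_mx 0 1; pose g (s : C) := u + s *: e.
have gE s j : g s 0 j = u 0 j + s * (j == 1)%:R by rewrite !mxE eqxx.
have gd (s : C) : is_derive s 1 g e.
  apply/is_derive_rowP => j.
  have -> : (fun t => g t 0 j) = (fun t => u 0 j + e 0 j * t).
    by apply/funext => t; rewrite !mxE mulrC.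
  have := is_deriveD (is_derive_cst (u 0 j) s 1)
    (is_deriveZ (e 0 j) (is_derive_id s 1)).
  by rewrite add0r /GRing.scale/= mulr1.
have g0 s : chart_vec 1 (g s) 0 0 = 0.
  by rewrite -l0 chart_vec_lift !mxE u0 /= mulr0 addr0.
have ns s : ~ singular F (chart 1 (g s)).
  move=> /singular_chart sg; have [[c01 _] _ _] := line_at_infinity sF (g0 s).
  by have /eqP := c01 (sg 0); rewrite chart_vec_k oner_eq0.
exists 1, g; split; first by move=> s; have [] := gd s.
have -> : chart 1 u = chart 1 (g 0) by rewrite /g scale0r addr0.
apply/seteqP; split.
  apply: leaf_subset; first by exists 0.
  move=> k f s t disc s1 t1 [r _ /chart_eqP[c c0 ce]].
  have vs0 : chart_vec k (f s) 0 0 = 0.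
    have := congr1 (fun v : 'rV_3 => v 0 0) ce; rewrite g0 mxE => /esym/eqP.
    by rewrite mulf_eq0 (negPf c0) => /eqP.
  have vt0 : chart_vec k (f t) 0 0 = 0.
    apply/eqP/negPn/negP => vt; have [] := disc_leaf sF disc t1 s1 vt.
    by rewrite vs0 eqxx.
  have [_ _ nst _] := disc t t1.
  have vt1 : chart_vec k (f t) 0 1 != 0 by exact: (regular_at_infinity sF).
  exists (affine_coords 1 (chart_vec k (f t)) 0 1 - u 0 1) => //.
  rewrite (chart_change vt1); congr chart; apply/rowP => j.
  rewrite gE; case: j => [[|[|//]] hj].
    have -> : Ordinal hj = 0 by exact/val_inj.
    by rewrite [RHS]mxE u0 mulr0 addr0 l0 vt0 mul0r.
  have -> : Ordinal hj = 1 by exact/val_inj.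
  by rewrite /= mulr1 subrKC.
apply: (range_subset_leaf gd) => //.
  move=> _; apply/eqP => /matrixP/(_ 0 1)/eqP.
  by rewrite !mxE /= oner_eq0.
move=> s; rewrite form_at_chart !big_ord_recl big_ord0 /=.
have -> : lift ord0 ord0 = 1 :> 'I_3 by exact/val_inj.
have -> : lift ord0 (lift ord0 ord0) = ord_max :> 'I_3 by exact/val_inj.
have [_ -> ->] := line_at_infinity sF (g0 s).
have -> : chart_velocity 1 e 0 ord0 = 0.
  have -> : ord0 = lift 1 (0 : 'I_2) :> 'I_3 by exact/val_inj.
  by rewrite mxE liftK /= mxE.
by rewrite !mul0r mulr0 !addr0.
Qed.

Lemma entire_leaves (m : proj_plane C) :
  ~ singular F m -> entire_curve (leaf F m).
Proof.
have [k [u ->]] := in_some_chart m => ns.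
have [v0|v0] := eqVneq (chart_vec k u 0 0) 0; last first.
  by rewrite (chart_change v0); exact: entire_affine_leaf.
have v1 : chart_vec k u 0 1 != 0 by exact: (regular_at_infinity sF).
rewrite (chart_change v1); apply: entire_leaf_at_infinity.
have l0 : lift 1 0 = 0 :> 'I_3 by exact/val_inj.
by rewrite mxE l0 v0 mul0r.
Qed.

Lemma complete_field : complete V /\ defined_by_field F ord0 V.
Proof.
split; first by move=> u; have [g [g0 gd _]] := field_flow sF u; exists g.
split; last exact: field_tangent sF.
by move=> u /eqP; rewrite (negPf (field_neq0 sF u)).
Qed.

End LevelSets.

(** * Foliations given by their coefficients *)

Section DerivativeRules.
Variables (K : numFieldType) (s : K).
Implicit Types (f g : K -> K) (a b c : K).

Lemma der_eq f a b : is_derive s 1 f a -> a = b -> is_derive s 1 f b.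
Proof. by move=> fa <-. Qed.

Lemma der_cst c : is_derive s 1 (fun _ : K => c) 0.
Proof. exact: is_derive_cst. Qed.

Lemma der_id : is_derive s 1 (fun t : K => t) 1.
Proof. exact: is_derive_id. Qed.

Lemma der_add f g a b : is_derive s 1 f a -> is_derive s 1 g b ->
  is_derive s 1 (fun t => f t + g t) (a + b).
Proof. by move=> fa gb; exact: is_deriveD. Qed.

Lemma der_opp f a : is_derive s 1 f a -> is_derive s 1 (fun t => - f t) (- a).
Proof. by move=> fa; exact: is_deriveN. Qed.

Lemma der_mul f g a b : is_derive s 1 f a -> is_derive s 1 g b ->
  is_derive s 1 (fun t => f t * g t) (f s * b + g s * a).
Proof. by move=> fa gb; exact: is_deriveM. Qed.

Lemma der_exp f a n : is_derive s 1 f a ->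
  is_derive s 1 (fun t => f t ^+ n) (n%:R * f s ^+ n.-1 * a).
Proof.
move=> fa; elim: n => [|n IH].
  by under eq_fun do rewrite expr0; rewrite !mul0r; exact: der_cst.
under eq_fun do rewrite exprS.
have := der_mul fa IH; congr is_derive.
by case: n {IH} => [|n] /=; rewrite ?expr0 ?expr1 ?exprS -?natr1; ring.
Qed.

End DerivativeRules.

Section ExponentialRule.
Variable R : realType.
Local Notation C := (R[i] : numClosedFieldType).

Lemma der_cexp (f : C -> C) (s a : C) :
  is_derive s 1 f a -> is_derive s 1 (fun t => cexp (f t)) (cexp (f s) * a).
Proof.
exact: (@is_derive_chain C (@cexp R) f s _ _ (is_derive_cexp (f s))).
Qed.

End ExponentialRule.

(** The rules are applied by the shape of the function, so that the resulting
    derivative is a plain ring expression. *)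
Ltac derive_rules :=
  lazymatch goal with
  | |- is_derive _ _ (fun _ => ?c) _ => notypeclasses refine (@der_cst _ _ c)
  | |- is_derive _ _ (fun t => t) _ => notypeclasses refine (@der_id _ _)
  | |- is_derive _ _ (fun t => @?f t + @?g t) _ =>
      notypeclasses refine (@der_add _ _ f g _ _ _ _); derive_rules
  | |- is_derive _ _ (fun t => - @?f t) _ =>
      notypeclasses refine (@der_opp _ _ f _ _); derive_rules
  | |- is_derive _ _ (fun t => @?f t * @?g t) _ =>
      notypeclasses refine (@der_mul _ _ f g _ _ _ _); derive_rules
  | |- is_derive _ _ (fun t => @?f t ^+ ?n) _ =>
      notypeclasses refine (@der_exp _ _ f _ n _); derive_rules
  | |- is_derive _ _ (fun t => cexp (@?f t)) _ =>
      notypeclasses refine (@der_cexp _ f _ _ _); derive_rules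
  | _ => eassumption
  end.


Section CoefficientBuilder.
Local Open Scope complex_scope.
Variable R : realType.
Local Notation C := (R[i] : numClosedFieldType).
Local Notation poly3 := (mpoly.mpoly 3 C).

Lemma chart_vec0E (u : 'rV[C]_2) : [/\ chart_vec ord0 u 0 0 = 1,
  chart_vec ord0 u 0 1 = u 0 0 & chart_vec ord0 u 0 ord_max = u 0 1].
Proof.
have l0 : 1 = lift ord0 (0 : 'I_2) by exact/val_inj.
have l1 : ord_max = lift ord0 (1 : 'I_2) by exact/val_inj.
by rewrite chart_vec_k l0 l1 !chart_vec_lift.
Qed.

Definition dehomogenize0 (p : poly3) : mpoly.mpoly 2 C :=
  mpoly.comp_mpoly [tuple oapp (@mvar C 2) 1 (unlift ord0 i) | i < 3] p.

(** This field spans the kernel of b dx + c dy, where b and c are the last two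
    homogeneous coefficients restricted to X = 1. *)
Definition dual_field (b c : poly3) : vector_field C :=
  \row_j (if j == 0 then - dehomogenize0 c else dehomogenize0 b).

Lemma meval_dehomogenize0 (p : poly3) (u : 'rV[C]_2) :
  mpoly.meval (u 0) (dehomogenize0 p) = mpoly.meval (chart_vec ord0 u 0) p.
Proof.
rewrite mpoly.comp_mpoly_meval; apply: mpoly.meval_eq => i.
rewrite tnth_mktuple [in RHS]mxE; case: (unlift ord0 i) => [j'|] /=.
  by rewrite mpoly.mevalXU.
by rewrite mpoly.meval1.
Qed.

(** The coefficients a, b, c are those of F up to the scalar k, and B dx + E dy
    is the restriction of the form to the chart X = 1. *)
Lemma solvable_foliation_of_coefs (F : foliation C 2) (k : C) (a b c : poly3)
    (H B E : C -> C -> C) : k != 0 ->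
  F 0 0 = k *: a -> F 0 1 = k *: b -> F 0 ord_max = k *: c ->
  (forall v : 'rV[C]_3, v 0 0 = 0 -> [/\ mpoly.meval (v 0) a = - v 0 1 ^+ 3,
    mpoly.meval (v 0) b = 0 & mpoly.meval (v 0) c = 0]) ->
  (forall u : 'rV[C]_2,
    mpoly.meval (chart_vec ord0 u 0) b = B (u 0 0) (u 0 1) /\
    mpoly.meval (chart_vec ord0 u 0) c = E (u 0 0) (u 0 1)) ->
  (forall x y, B x y = 0 -> E x y = 0 -> False) ->
  (forall x0 y0 : C, exists x y : C -> C,
    [/\ x 0 = x0, y 0 = y0,
      forall s : C, is_derive s 1 x (- E (x s) (y s)) /\
                    is_derive s 1 y (B (x s) (y s)) &
      forall x1 y1, H x1 y1 = H x0 y0 -> exists2 s, x s = x1 & y s = y1]) ->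
  (forall (x y : C -> C) (s dx dy : C), is_derive s 1 x dx -> is_derive s 1 y dy ->
    B (x s) (y s) * dx + E (x s) (y s) * dy = 0 ->
    is_derive s 1 (fun t => H (x t) (y t)) 0) ->
  (forall (x y : R -> C) (c : C) (T : R), 0 < T ->
    (forall t : R, 0 < t < T ->
      [/\ {for t, continuous (fun r => complex.Re (x r))},
          {for t, continuous (fun r => complex.Im (x r))},
          {for t, continuous (fun r => complex.Re (y r))} &
          {for t, continuous (fun r => complex.Im (y r))}]) ->
    (forall t : R, 0 < t < T -> H (x t) (y t) = c) ->
    (forall M : R, \forall t \near T^'-, M%:C <= `|x t|) ->
    (exists M : R, \forall t \near T^'-, `|y t| <= M%:C * `|x t|) ->
    False) ->
  solvable_foliation F (dual_field b c) (fun u => H (u 0 0) (u 0 1)).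
Proof.
move=> k0 Fa Fb Fc inf bcE reg flow fint noesc.
have bE u := (bcE u).1; have cE u := (bcE u).2.
have coefZ (v : 'rV[C]_3) i p : F 0 i = k *: p ->
    coef_at F v i = k * mpoly.meval (v 0) p.
  by rewrite /coef_at => ->; rewrite mpoly.mevalZ.
have l0 : lift ord0 (0 : 'I_2) = 1 by exact/val_inj.
have l1 : lift ord0 (1 : 'I_2) = ord_max by exact/val_inj.
have fieldE u : field_at (dual_field b c) u =
    \row_j (if j == 0 then - E (u 0 0) (u 0 1) else B (u 0 0) (u 0 1)).
  apply/rowP => j; rewrite !mxE; case: ifP => _.
    by rewrite mpoly.mevalN meval_dehomogenize0 cE.
  by rewrite meval_dehomogenize0 bE.
have row2 (x y : C) j :
    (\row_j (if j == 0 then x else y) : 'rV[C]_2) 0 j = if j == 0 then x else y.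
  by rewrite mxE.
have I2 (P : 'I_2 -> Prop) : P 0 -> P 1 -> forall j, P j.
  by move=> P0 P1 [[|[|//]] hj]; [move: P0|move: P1]; congr P; exact/val_inj.
split.
- move=> v v0; have [ev0 ev1 ev2] := inf v v0.
  rewrite !(coefZ _ _ _ Fa, coefZ _ _ _ Fb, coefZ _ _ _ Fc) ev0 ev1 ev2 !mulr0.
  split => //.
  split=> [/eqP|->]; last by rewrite expr0n oppr0 mulr0.
  by rewrite mulf_eq0 (negPf k0) oppr_eq0 expf_eq0 /= => /eqP.
- move=> u; have [b0|b0] := eqVneq (B (u 0 0) (u 0 1)) 0; last first.
    by exists 1; rewrite (coefZ _ _ _ Fb) bE mulf_neq0.
  exists ord_max; rewrite (coefZ _ _ _ Fc) cE mulf_neq0//.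
  by apply/eqP => c0; exact: reg b0 c0.
- move=> u; rewrite fieldE; apply/eqP => /rowP e.
  have := e 0; have := e 1; rewrite !mxE /= => b0 /eqP; rewrite oppr_eq0 => /eqP.
  exact: reg.
- rewrite !big_ord_recl big_ord0 addr0 /= ![chart_form _ _ _ _]mxE.
  rewrite ![dual_field _ _ _ _]mxE /=.
  have -> : lift ord0 (ord0 : 'I_2) = 1 by exact/val_inj.
  have -> : lift ord0 (lift ord0 (ord0 : 'I_1)) = ord_max :> 'I_3 by exact/val_inj.
  rewrite Fb Fc -/(dehomogenize0 _) -/(dehomogenize0 (k *: c)) /dehomogenize0.
  rewrite !mpoly.comp_mpolyZ.
  move: (mpoly.comp_mpoly _ b) (mpoly.comp_mpoly _ c) => b' c'.
  by rewrite -!mpoly.mul_mpolyC mulrN mulrAC addNr.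
- move=> u; have [x [y [x0 y0 D lvl]]] := flow (u 0 0) (u 0 1).
  exists (fun s => \row_j (if j == 0 then x s else y s)); split.
  + by apply/rowP; apply: I2; rewrite mxE.
  + move=> s; apply/is_derive_rowP => j; rewrite fieldE.
    have [Dx Dy] := D s; rewrite !row2; under eq_fun do rewrite row2.
    by case: ifP.
  + move=> u' /lvl[s xs ys]; exists s; apply/rowP; apply: I2; by rewrite mxE.
- move=> g s d /is_derive_rowP gd tan; apply: (fint _ _ _ _ _ (gd 0) (gd 1)).
  apply: (mulfI k0); rewrite mulr0 -[RHS]tan form_at_chart.
  rewrite !big_ord_recl big_ord0 addr0.
  have -> : lift ord0 (lift ord0 (ord0 : 'I_1)) = ord_max :> 'I_3 by exact/val_inj.
  have -> : lift ord0 (ord0 : 'I_2) = 1 by exact/val_inj.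
  rewrite (coefZ _ _ _ Fb) (coefZ _ _ _ Fc) bE cE.
  have -> : chart_velocity ord0 d 0 ord0 = 0 by rewrite mxE unlift_none.
  have -> : chart_velocity ord0 d 0 1 = d 0 0 by rewrite -l0 mxE liftK.
  have -> : chart_velocity ord0 d 0 ord_max = d 0 1 by rewrite -l1 mxE liftK.
  by rewrite mulr0 add0r mulrDr !mulrA.
- move=> u e T T0 uc He x_oo xy; apply: (noesc _ _ e T T0 _ He x_oo xy) => t tT.
  by have [? ?] := uc t 0 tT; have [? ?] := uc t 1 tT.
Qed.

End CoefficientBuilder.

(** * Level curves of the three first integrals *)

Section RealNorm.
Local Open Scope complex_scope.
Variable R : realType.
Local Notation C := (R[i] : numClosedFieldType).
Implicit Types z w : C.

Definition rnorm z : R := complex.Re `|z|.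

Lemma rnormE z : `|z| = (rnorm z)%:C.
Proof. exact: normc_realE. Qed.

Lemma rnorm_ge0 z : 0 <= rnorm z.
Proof. exact: Re_norm_ge0. Qed.

Lemma rnormD z w : rnorm (z + w) <= rnorm z + rnorm w.
Proof. by rewrite -lecR rmorphD /= -!rnormE; exact: ler_normD. Qed.

Lemma rnormN z : rnorm (- z) = rnorm z.
Proof. by rewrite /rnorm normrN. Qed.

Lemma rnormM z w : rnorm (z * w) = rnorm z * rnorm w.
Proof. by apply: complexI; rewrite rmorphM /= -!rnormE normrM. Qed.

Lemma rnormX z n : rnorm (z ^+ n) = rnorm z ^+ n.
Proof. by apply: complexI; rewrite rmorphXn /= -!rnormE normrX. Qed.

Lemma rnorm_nat n : rnorm n%:R = n%:R.
Proof. by apply: complexI; rewrite -rnormE normr_nat rmorph_nat. Qed.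

Lemma ler_rnorm (M : R) z : (M%:C <= `|z|) = (M <= rnorm z).
Proof. by rewrite rnormE lecR. Qed.

Lemma rnorm_ler (M : R) z w : (`|z| <= M%:C * `|w|) = (rnorm z <= M * rnorm w).
Proof. by rewrite !rnormE -rmorphM lecR. Qed.

Lemma quarter_rnorm z w :
  (4 * `|z| <= `|w| ^+ 2) = (4 * rnorm z <= rnorm w ^+ 2).
Proof.
rewrite !rnormE -rmorphXn -[in LHS](rmorph_nat (real_complex R) 4).
by rewrite -rmorphM lecR.
Qed.

End RealNorm.

Section NoEscape.
Local Open Scope complex_scope.
Variable R : realType.
Local Notation C := (R[i] : numClosedFieldType).
Variables (x y : R -> C) (c : C) (T : R).
Hypothesis T0 : 0 < T.
Hypothesis xy_continuous : forall t : R, 0 < t < T ->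
  [/\ {for t, continuous (fun r => complex.Re (x r))},
      {for t, continuous (fun r => complex.Im (x r))},
      {for t, continuous (fun r => complex.Re (y r))} &
      {for t, continuous (fun r => complex.Im (y r))}].
Hypothesis x_oo : forall M : R, \forall t \near T^'-, M%:C <= `|x t|.
Hypothesis y_le : exists M : R, \forall t \near T^'-, `|y t| <= M%:C * `|x t|.

Lemma near_inside : \forall t \near T^'-, 0 < t < T.
Proof.
near=> t; apply/andP; split; near: t; [exact: nbhs_left_gt|exact: nbhs_left_lt].
Unshelve. all: by end_near. Qed.

Lemma y_rnorm_le : exists2 M : R, 0 <= M &
  \forall t \near T^'-, rnorm (y t) <= M * rnorm (x t).
Proof.
have [M yM] := y_le; exists `|M| => //; near=> t.
apply: (@le_trans _ _ (M * rnorm (x t))).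
  by rewrite -rnorm_ler; near: t.
by rewrite ler_wpM2r ?rnorm_ge0// ler_norm.
Unshelve. all: by end_near. Qed.

Lemma x_rnorm_ge (M : R) : \forall t \near T^'-, M <= rnorm (x t).
Proof. by apply: filterS (x_oo M) => t; rewrite ler_rnorm. Qed.

(** The cubic term dominates y = O(x). *)
Lemma no_escape_cubic :
  (forall t : R, 0 < t < T -> y t - x t ^+ 3 / 3 = c) -> False.
Proof.
move=> e; have [M M0 yM] := y_rnorm_le.
near (T^'-) => t.
have tT : 0 < t < T by near: t; exact: near_inside.
have y1 : rnorm (y t) <= M * rnorm (x t) by near: t.
have x1 : 3 * rnorm c + 3 * M + 1 <= rnorm (x t) by near: t; exact: x_rnorm_ge.
have : rnorm (x t) ^+ 3 <= 3 * (rnorm (y t) + rnorm c).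
  have -> : rnorm (x t) ^+ 3 = rnorm (3 * (y t - c)).
    by rewrite -rnormX; congr rnorm; rewrite -(e t tT); field; rewrite ?pnatr_eq0.
  rewrite rnormM rnorm_nat ler_wpM2l//.
  by apply: (le_trans (rnormD _ _)); rewrite rnormN.
have := rnorm_ge0 c.
move: (rnorm c) (rnorm (x t)) (rnorm (y t)) x1 y1 => q n p x1 y1 q0 n3.
have n1 : 1 <= n by lra.
have : 3 * (q + M * n) <= n * (n - 1) by nra.
have : n ^+ 3 = n * n * n by ring.
by nra.
Unshelve. all: by end_near. Qed.

(** The level equation reads e^x c = x^2 + O(x). *)
Lemma no_escape_exp1 :
  (forall t : R, 0 < t < T ->
     cexp (- x t) * (y t + x t ^+ 2 + 2 * x t + 2) = c) -> False.
Proof.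
move=> e; have [M M0 yM] := y_rnorm_le.
apply: (@cexp_no_escape R x (fun t => y t + x t ^+ 2 + 2 * x t + 2) c T T0).
- by move=> t /xy_continuous[].
- by move=> t tT; rewrite -(e t tT) mulrA cexpxN mul1r.
- exact: x_oo.
near=> t; rewrite quarter_rnorm.
have y1 : rnorm (y t) <= M * rnorm (x t) by near: t.
have x1 : 4 * M + 16 <= rnorm (x t) by near: t; exact: x_rnorm_ge.
have : rnorm (y t + x t ^+ 2 + 2 * x t + 2 - x t ^+ 2) <=
    rnorm (y t) + 2 * rnorm (x t) + 2.
  have -> : y t + x t ^+ 2 + 2 * x t + 2 - x t ^+ 2 = y t + 2 * x t + 2 by ring.
  apply: (le_trans (rnormD _ _)); rewrite rnorm_nat lerD2r.
  by apply: (le_trans (rnormD _ _)); rewrite rnormM rnorm_nat.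
move: (rnorm (_ - _)) (rnorm (x t)) (rnorm (y t)) x1 y1 => p n q x1 y1 p1.
by nra.
Unshelve. all: by end_near. Qed.

(** The fourth power of the level equation, in terms of v = 4y - 2x^2, reads
    e^v (4 c^4) = 4 x^4, and v^2 = 4 x^4 + O(x^3). *)
Lemma no_escape_exp2 :
  (forall t : R, 0 < t < T -> x t * cexp (x t ^+ 2 / 2 - y t) = c) -> False.
Proof.
move=> e; have [M M0 yM] := y_rnorm_le.
pose v t := 4 * y t - 2 * x t ^+ 2.
have xv : \forall t \near T^'-,
    2 * rnorm (x t) * (rnorm (x t) - 2 * M) <= rnorm (v t).
  near=> t.
  have y1 : rnorm (y t) <= M * rnorm (x t) by near: t.
  have : rnorm (2 * x t ^+ 2) <= rnorm (- v t) + rnorm (4 * y t).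
    by apply: le_trans (rnormD _ _); rewrite /v opprB subrK.
  rewrite rnormN rnormM [rnorm (4 * _)]rnormM rnormX !rnorm_nat.
  by nra.
apply: (@cexp_no_escape R v (fun t => 4 * x t ^+ 4) (4 * c ^+ 4) T T0).
- move=> t /xy_continuous[c1 c2 c3 c4].
  have -> : (@complex.Im R) \o v = (fun r =>
      4 * complex.Im (y r) - 4 * (complex.Re (x r) * complex.Im (x r))).
    apply/funext => r; rewrite /v /=; case: (x r) (y r) => [a b] [a' b'].
    by rewrite /= ; ring.
  have cst4 : {for t, continuous (fun _ : R => 4 : R)} by exact: cst_continuous.
  exact: (continuousB (continuousM cst4 c4) (continuousM cst4 (continuousM c1 c2))).
- move=> t tT; rewrite -(e t tT) exprMn.
  have -> : cexp (x t ^+ 2 / 2 - y t) ^+ 4 = cexp (- v t).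
    have -> : - v t = let z := x t ^+ 2 / 2 - y t in z + (z + (z + z)).
      by rewrite /v /=; field; rewrite ?pnatr_eq0.
    by rewrite /= !cexpD; ring.
  by rewrite mulrCA [cexp (v t) * _]mulrCA cexpxN mulr1.
- move=> P; near=> t; rewrite ler_rnorm.
  have x1 : 2 * M + `|P| + 1 <= rnorm (x t) by near: t; exact: x_rnorm_ge.
  apply: (@le_trans _ _ (2 * rnorm (x t) * (rnorm (x t) - 2 * M))); last by near: t.
  have := ler_norm P; have := normr_ge0 P.
  move: (rnorm (x t)) x1 => n x1 P0 P1.
  by nra.
near=> t; rewrite quarter_rnorm.
have y1 : rnorm (y t) <= M * rnorm (x t) by near: t.
have x1 : 21 * M + 1 <= rnorm (x t) by near: t; exact: x_rnorm_ge.
have v1 : 2 * rnorm (x t) * (rnorm (x t) - 2 * M) <= rnorm (v t) by near: t.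
have -> : 4 * x t ^+ 4 - v t ^+ 2 = 16 * y t * (x t ^+ 2 - y t) by rewrite /v; ring.
rewrite !rnormM rnorm_nat.
have : rnorm (x t ^+ 2 - y t) <= rnorm (x t) ^+ 2 + rnorm (y t).
  by apply: (le_trans (rnormD _ _)); rewrite rnormN rnormX.
have := rnorm_ge0 (y t); have := rnorm_ge0 (x t ^+ 2 - y t).
move: (rnorm (x t)) (rnorm (y t)) (rnorm (v t)) (rnorm (x t ^+ 2 - y t)) x1 y1 v1.
move=> n q w r x1 y1 v1 r0 q0 rn.
have n0 : 0 <= n by nra.
have n2M : 0 <= n - 2 * M by nra.
have lo : (2 * n * (n - 2 * M)) ^+ 2 <= w ^+ 2.
  have L0 : 0 <= 2 * n * (n - 2 * M) by rewrite !mulr_ge0.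
  by apply: lerXn2r => //; rewrite nnegrE (le_trans L0).
apply: le_trans lo.
have qr : q * r <= (M * n) * (n ^+ 2 + M * n).
  by rewrite ler_pM//; lra.
have -> : (2 * n * (n - 2 * M)) ^+ 2 = 4 * (n ^+ 2 * (n - 2 * M) ^+ 2) by ring.
have -> : 4 * (16 * q * r) = 4 * (16 * (q * r)) by ring.
rewrite ler_wpM2l//; apply: (@le_trans _ _ (16 * (M * n * (n ^+ 2 + M * n)))).
  by rewrite ler_wpM2l.
have -> : 16 * (M * n * (n ^+ 2 + M * n)) = n ^+ 2 * (16 * M * (n + M)) by ring.
rewrite ler_wpM2l ?sqr_ge0//.
by nra.
Unshelve. all: by end_near. Qed.

End NoEscape.

(** * The three foliations *)

Section Coefficients.
Variable K : numClosedFieldType.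
Let X := mvar K (0 : 'I_3).
Let Y := mvar K (1 : 'I_3).
Let Z := mvar K (ord_max : 'I_3).

Let mE := (rmorphB, rmorphD, rmorphN, rmorphM, rmorphXn).
Let cX := mpoly.comp_mpolyXU.

Lemma meval_mvar n (v : 'rV[K]_n) (i : 'I_n) : mpoly.meval (v 0) (mvar K i) = v 0 i.
Proof. exact: mpoly.mevalXU. Qed.

Definition has_coefs (F : foliation K 2) (A B E : K -> K -> K -> K) : Prop :=
  exists k a b c, [/\ k != 0, F 0 0 = k *: a, F 0 1 = k *: b, F 0 ord_max = k *: c &
    forall v : 'rV[K]_3, [/\ mpoly.meval (v 0) a = A (v 0 0) (v 0 1) (v 0 ord_max),
      mpoly.meval (v 0) b = B (v 0 0) (v 0 1) (v 0 ord_max) &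
      mpoly.meval (v 0) c = E (v 0 0) (v 0 1) (v 0 ord_max)]].

Lemma omega1_coefs (F : foliation K 2) :
  described_in_chart F ord_max (omega1 K) ->
  has_coefs F (fun x y z => x ^+ 2 * z - y ^+ 3) (fun x y z => x * y ^+ 2)
    (fun x y z => - x ^+ 3).
Proof.
pose a := X*X*Z - Y*Y*Y; pose b := X*Y*Y; pose c := - (X*X*X).
move=> hF; have [||||| k [k0 Fa Fb Fc]] := @foliation_coefs K F (omega1 K) a b c hF.
- by rewrite rpredB // mvarM3_homog.
- exact: mvarM3_homog.
- by rewrite /a /X /Y /Z !mE /= /mvar !cX /= !mxE /=; rewrite /mvar; ring.
- by rewrite /b /X /Y /Z !mE /= /mvar !cX /= !mxE /=; rewrite /mvar; ring.
- by rewrite /a /b /c /X /Y /Z; ring.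
exists k, a, b, c; split => // v.
by rewrite /a /b /c /X /Y /Z !mE /= !meval_mvar; split; ring.
Qed.

Lemma omega2_coefs (F : foliation K 2) :
  described_in_chart F ord_max (omega2 K) ->
  has_coefs F (fun x y z => x ^+ 2 * z - x * y * z - y ^+ 3)
    (fun x y z => x ^+ 2 * z + x * y ^+ 2)
    (fun x y z => - x ^+ 3).
Proof.
pose a := X*X*Z - X*Y*Z - Y*Y*Y; pose b := X*X*Z+X*Y*Y; pose c := - (X*X*X).
move=> hF; have [||||| k [k0 Fa Fb Fc]] := @foliation_coefs K F (omega2 K) a b c hF.
- by rewrite !rpredB // mvarM3_homog.
- by rewrite rpredD // mvarM3_homog.
- by rewrite /a /X /Y /Z !mE /= /mvar !cX /= !mxE /=; rewrite /mvar; ring.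
- by rewrite /b /X /Y /Z !mE /= /mvar !cX /= !mxE /=; rewrite /mvar; ring.
- by rewrite /a /b /c /X /Y /Z; ring.
exists k, a, b, c; split => // v.
by rewrite /a /b /c /X /Y /Z !mE /= !meval_mvar; split; ring.
Qed.

Lemma omega3_coefs (F : foliation K 2) :
  described_in_chart F ord_max (omega3 K) ->
  has_coefs F (fun x y z => x * y * z - x ^+ 2 * y - y ^+ 3)
    (fun x y z => x ^+ 3 + x * y ^+ 2)
    (fun x y z => - (x ^+ 2 * y)).
Proof.
pose a := X*Y*Z - X*X*Y - Y*Y*Y; pose b := X*X*X+X*Y*Y; pose c := - (X*X*Y).
move=> hF; have [||||| k [k0 Fa Fb Fc]] := @foliation_coefs K F (omega3 K) a b c hF.
- by rewrite !rpredB // mvarM3_homog.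
- by rewrite rpredD // mvarM3_homog.
- by rewrite /a /X /Y /Z !mE /= /mvar !cX /= !mxE /=; rewrite /mvar; ring.
- by rewrite /b /X /Y /Z !mE /= /mvar !cX /= !mxE /=; rewrite /mvar; ring.
- by rewrite /a /b /c /X /Y /Z; ring.
exists k, a, b, c; split => // v.
by rewrite /a /b /c /X /Y /Z !mE /= !meval_mvar; split; ring.
Qed.

End Coefficients.

Section Cases.
Local Open Scope complex_scope.
Variable R : realType.
Local Notation C := (R[i] : numClosedFieldType).

Lemma solvable_omega1 (F : foliation C 2) :
  described_in_chart F ord_max (omega1 C) -> exists V H, solvable_foliation F V H.
Proof.
move=> /omega1_coefs[k [a [b [c [k0 Fa Fb Fc abc]]]]].
exists (dual_field b c), (fun u => u 0 1 - u 0 0 ^+ 3 / 3).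
apply: (@solvable_foliation_of_coefs R F k a b c (fun x y => y - x ^+ 3 / 3)
  (fun x y => x ^+ 2) (fun x y => -1)) => //.
- by move=> v v0; have [-> -> ->] := abc v; rewrite v0; split; ring.
- move=> u; have [_ -> ->] := abc (chart_vec ord0 u).
  by have [e0 e1 e2] := chart_vec0E u; rewrite !(e0, e1, e2); split; ring.
- by move=> x y _ /eqP; rewrite oppr_eq0 oner_eq0.
- move=> x0 y0.
  exists (fun s => x0 + s), (fun s => y0 + ((x0 + s) ^+ 3 - x0 ^+ 3) / 3).
  split.
  + by rewrite addr0.
  + by rewrite addr0 subrr mul0r addr0.
  + move=> s; split; (notypeclasses refine (der_eq _ _); first derive_rules).
      by rewrite /= opprK add0r.
    by rewrite /=; field; rewrite ?pnatr_eq0.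
  + move=> x1 y1 e; exists (x1 - x0); rewrite subrKC//.
    have -> : y1 = (y1 - x1 ^+ 3 / 3) + x1 ^+ 3 / 3 by rewrite subrK.
    by rewrite e; field; rewrite ?pnatr_eq0.
- move=> x y s dx dy Dx Dy tan.
  notypeclasses refine (der_eq _ _); first derive_rules.
  transitivity (- (x s ^+ 2 * dx + -1 * dy)); last by rewrite tan oppr0.
  by rewrite /=; field; rewrite ?pnatr_eq0.
- by move=> x y e T T0 xyc He x_oo xy; apply: (no_escape_cubic T0 x_oo xy He).
Qed.

Lemma solvable_omega2 (F : foliation C 2) :
  described_in_chart F ord_max (omega2 C) -> exists V H, solvable_foliation F V H.
Proof.
move=> /omega2_coefs[k [a [b [c [k0 Fa Fb Fc abc]]]]].
pose h (x y : C) : C := cexp (- x) * (y + x ^+ 2 + 2 * x + 2).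
exists (dual_field b c), (fun u => h (u 0 0) (u 0 1)).
apply: (@solvable_foliation_of_coefs R F k a b c h
  (fun x y => y + x ^+ 2) (fun x y => -1)) => //.
- by move=> v v0; have [-> -> ->] := abc v; rewrite v0; split; ring.
- move=> u; have [_ -> ->] := abc (chart_vec ord0 u).
  by have [e0 e1 e2] := chart_vec0E u; rewrite !(e0, e1, e2); split; ring.
- by move=> x y _ /eqP; rewrite oppr_eq0 oner_eq0.
- move=> x0 y0; exists (fun s => x0 + s), (fun s =>
    (y0 + x0 ^+ 2 + 2 * x0 + 2) * cexp s + - ((x0 + s) ^+ 2 + 2 * (x0 + s) + 2)).
  split.
  + by rewrite addr0.
  + by rewrite addr0 cexp0; ring.
  + move=> s; split; (notypeclasses refine (der_eq _ _); first derive_rules).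
      by rewrite /= opprK add0r.
    by rewrite /=; ring.
  + move=> x1 y1 e; exists (x1 - x0); rewrite subrKC//.
    have -> : y0 + x0 ^+ 2 + 2 * x0 + 2 = cexp x0 * h x0 y0.
      by rewrite /h [RHS]mulrA cexpxN mul1r.
    by rewrite -e mulrAC -cexpD subrKC /h mulrA cexpxN mul1r; ring.
- move=> x y s dx dy Dx Dy tan; rewrite /h.
  notypeclasses refine (der_eq _ _); first derive_rules.
  transitivity (- cexp (- x s) * ((y s + x s ^+ 2) * dx + -1 * dy));
    last by rewrite tan mulr0.
  by rewrite /=; ring.
- by move=> x y e T T0 xyc He x_oo xy; apply: (no_escape_exp1 T0 xyc x_oo xy He).
Qed.

Lemma solvable_omega3 (F : foliation C 2) :
  described_in_chart F ord_max (omega3 C) -> exists V H, solvable_foliation F V H.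
Proof.
move=> /omega3_coefs[k [a [b [c [k0 Fa Fb Fc abc]]]]].
pose h (x y : C) : C := x * cexp (x ^+ 2 / 2 - y).
exists (dual_field b c), (fun u => h (u 0 0) (u 0 1)).
apply: (@solvable_foliation_of_coefs R F k a b c h
  (fun x y => 1 + x ^+ 2) (fun x y => - x)) => //.
- by move=> v v0; have [-> -> ->] := abc v; rewrite v0; split; ring.
- move=> u; have [_ -> ->] := abc (chart_vec ord0 u).
  by have [e0 e1 e2] := chart_vec0E u; rewrite !(e0, e1, e2); split; ring.
- move=> x y e /eqP; rewrite oppr_eq0 => /eqP x0.
  by move/eqP: e; rewrite x0 expr0n addr0 oner_eq0.
- move=> x0 y0; exists (fun s => x0 * cexp s), (fun s =>
    y0 + s + ((x0 * cexp s) ^+ 2 - x0 ^+ 2) / 2).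
  split.
  + by rewrite cexp0 mulr1.
  + by rewrite cexp0 mulr1; ring.
  + move=> s; split; (notypeclasses refine (der_eq _ _); first derive_rules).
      by rewrite /= opprK; ring.
    by rewrite /=; field; rewrite ?pnatr_eq0.
  + (* The flow time is read off from the second component, where it enters
       linearly; the level equation then gives the first component. *)
    move=> x1 y1 e; pose s := y1 - y0 - (x1 ^+ 2 - x0 ^+ 2) / 2.
    have xs : x0 * cexp s = x1.
      have -> : s = (x0 ^+ 2 / 2 - y0) + - (x1 ^+ 2 / 2 - y1).
        by rewrite /s; field; rewrite ?pnatr_eq0.
      rewrite cexpD mulrA -/(h x0 y0) -e /h -mulrA.
      by rewrite -mulrA cexpxN mulr1.
    by exists s; rewrite xs// /s; ring.
- move=> x y s dx dy Dx Dy tan; rewrite /h.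
  notypeclasses refine (der_eq _ _); first derive_rules.
  transitivity (cexp (x s ^+ 2 / 2 - y s) *
    ((1 + x s ^+ 2) * dx + - x s * dy)); last by rewrite tan mulr0.
  by rewrite /=; field; rewrite ?pnatr_eq0.
- by move=> x y e T T0 xyc He x_oo xy; apply: (no_escape_exp2 T0 xyc x_oo xy He).
Qed.
End Cases.

(* The chart Z = 1 is [ord_max] and the chart X = 1 is [ord0]. *)
Theorem proposition2 (R : realType) (w : one_form R[i] 2)
    (hw : [\/ w = omega1 R[i], w = omega2 R[i] | w = omega3 R[i]])
    (F : foliation R[i] 2) (hF : described_in_chart F ord_max w) :
  (forall m : proj_plane R[i], ~ singular F m -> entire_curve (leaf F m)) /\
  (exists V : vector_field R[i], complete V /\ defined_by_field F ord0 V).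
Proof.
have [V [H sF]] : exists V H, solvable_foliation F V H.
  case: hw hF => ->; [exact: solvable_omega1|exact: solvable_omega2|].
  exact: solvable_omega3.
split; first by move=> m; exact: (entire_leaves sF).
by exists V; exact: (complete_field sF).
Qed.
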